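(* Let $\mu>0$, let $\mathcal{A}:\mathbb{M}_{n_1,n_2}\to\mathbb{F}^m$ be a linear operator with $\|\mathcal{A}\|<1$, and let $K\ge 1$ be an integer with $\delta_{2K}^-<1$. Suppose that $b=\mathcal{A}X_0+\epsilon$, where $X_0\in\mathbb{M}_{n_1,n_2}$ has $\mathrm{rank}(X_0)=K$ and $\epsilon\in\mathbb{F}^m$. Assume that $$\|\epsilon\|_2\le \frac{(1-\delta_{2K}^-)^{3/2}\sqrt{\mu}}{3}\qquad\text{and}\qquad \sigma_K(X_0)>\left(\frac{1}{1-\delta_{2K}^-}+(1-\delta_{2K}^-)\right)\sqrt{\mu}.$$ Then the problem $\operatorname{arg\,min}_{\mathrm{rank}(X)\le K}\|\mathcal{A}X-b\|_2$ has a unique solution $X_B$ (the best rank $K$ solution), and $X_B$ equals the (also unique) global minimizer over $X\in\mathbb{M}_{n_1,n_2}$ of $$\mathcal{R}_{\mu,reg}(X)=\sum_i r_\mu(\sigma_i(X))+\|\mathcal{A}X-b\|_2^2$$ as well as of $$\mathcal{R}_\mu(X)=\mu\,\mathrm{rank}(X)+\|\mathcal{A}X-b\|_2^2 .$$ Moreover $$\|X_B-X_0\|_F\le \frac{2\|\epsilon\|_2}{\sqrt{1-\delta_{2K}^-}},$$ and $\mathrm{rank}(X)>K$ for any other stationary point $X$ of $\mathcal{R}_{\mu,reg}$.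
   Context: $\mathbb{F}$ is $\mathbb{R}$ or $\mathbb{C}$, and $\mathbb{M}_{n_1,n_2}$ is the space of $n_1\times n_2$ matrices with entries in $\mathbb{F}$, equipped with the Frobenius norm $\|\cdot\|_F$. $\sigma_1(X)\ge\sigma_2(X)\ge\dots\ge\sigma_n(X)\ge 0$, $n=\min(n_1,n_2)$, are the singular values of $X$. $\|\mathcal{A}\|$ is the operator norm of $\mathcal{A}$ from $(\mathbb{M}_{n_1,n_2},\|\cdot\|_F)$ to $(\mathbb{F}^m,\|\cdot\|_2)$. The function $r_\mu$ is $r_\mu(\sigma)=\mu-\max(\sqrt{\mu}-\sigma,0)^2$ for $\sigma\ge 0$. The lower restricted isometry constant $\delta_{J}^-$ of $\mathcal{A}$ is defined, for an integer $J\ge1$, by $$1-\delta_J^-=\inf\left\{\frac{\|\mathcal{A}X\|_2^2}{\|X\|_F^2}: X\in\mathbb{M}_{n_1,n_2},\ X\ne 0,\ \mathrm{rank}(X)\le J\right\}.$$ A point $X$ is stationary for a functional $g$ if $\liminf_{Y\to X,\,Y\ne X}\frac{g(Y)-g(X)}{\|Y-X\|_F}\ge 0$. *)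

(* Defs.v *)
From HB Require Import structures.
From mathcomp Require Import all_boot all_order all_algebra.
From mathcomp Require Import complex.
From mathcomp Require Import all_classical all_reals all_analysis.

Set Implicit Arguments.
Unset Strict Implicit.
Unset Printing Implicit Defensive.

Import Order.TTheory GRing.Theory Num.Theory.
Import numFieldNormedType.Exports.

Local Open Scope classical_set_scope.
Local Open Scope ring_scope.
Local Open Scope complex_scope.
Local Open Scope sesquilinear_scope.

(* [entries R k] is the field of the matrix entries: R or C = R[i]. *)
Inductive scalar_kind := RealScalars | ComplexScalars.

Definition entries (R : realType) (k : scalar_kind) : numFieldType :=
  match k with
  | RealScalars => R
  | ComplexScalars => R[i]
  end.

Definition toC (R : realType) (k : scalar_kind) : entries R k -> R[i] :=
  match k with
  | RealScalars => fun x : R => x%:C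
  | ComplexScalars => fun z : R[i] => z
  end.

Definition modulus (R : realType) (k : scalar_kind) (x : entries R k) : R :=
  ComplexField.Normc.normc (toC x).

(* On column vectors this is the Euclidean norm.  The library norm `|X| on
   matrices is the max norm (with the same topology). *)
Definition frob (R : realType) (k : scalar_kind) (p q : nat)
    (X : 'M[entries R k]_(p, q)) : R :=
  Num.sqrt (\sum_(i < p) \sum_(j < q) modulus (X i j) ^+ 2).

(* Square roots of the eigenvalues of X^* X, with multiplicity, in decreasing
   order.  This list has length q; for i < min(p, q), its i-th entry (counted
   from 0) is the singular value usually written sigma_(i+1)(X), and its
   entries of index >= min(p, q) are 0. *)
Definition singular_values (R : realType) (k : scalar_kind) (p q : nat)
    (X : 'M[entries R k]_(p, q)) : seq R :=
  let XC : 'M[R[i]]_(p, q) := map_mx (@toC R k) X in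
  let lambda : 'rV[R[i]]_q := spectral_diag (XC ^t* *m XC) in
  sort (fun s t => t <= s)
    [seq Num.sqrt (complex.Re (lambda 0 j)) | j <- enum 'I_q].

Definition sigma (R : realType) (k : scalar_kind) (p q : nat)
    (X : 'M[entries R k]_(p, q)) (i : nat) : R :=
  nth 0 (singular_values X) i.

Definition opnorm (R : realType) (k : scalar_kind) (n1 n2 m : nat)
    (A : 'M[entries R k]_(n1, n2) -> 'cV[entries R k]_m) : R :=
  sup [set frob (A X) | X in [set X | frob X <= 1]].

Definition lower_ric (R : realType) (k : scalar_kind) (n1 n2 m : nat)
    (A : 'M[entries R k]_(n1, n2) -> 'cV[entries R k]_m) (J : nat) : R :=
  1 - inf [set frob (A X) ^+ 2 / frob X ^+ 2 |
           X in [set X | X != 0 /\ (\rank X <= J)%N]].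

Definition r_mu (R : realType) (mu s : R) : R :=
  mu - Num.max (Num.sqrt mu - s) 0 ^+ 2.

Definition R_mu_reg (R : realType) (k : scalar_kind) (n1 n2 m : nat) (mu : R)
    (A : 'M[entries R k]_(n1, n2) -> 'cV[entries R k]_m) (b : 'cV[entries R k]_m)
    (X : 'M[entries R k]_(n1, n2)) : R :=
  \sum_(i < minn n1 n2) r_mu mu (sigma X i) + frob (A X - b) ^+ 2.

Definition R_mu (R : realType) (k : scalar_kind) (n1 n2 m : nat) (mu : R)
    (A : 'M[entries R k]_(n1, n2) -> 'cV[entries R k]_m) (b : 'cV[entries R k]_m)
    (X : 'M[entries R k]_(n1, n2)) : R :=
  mu * (\rank X)%:R + frob (A X - b) ^+ 2.

Definition argmin (T : Type) (R : realType) (D : set T) (g : T -> R) : set T :=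
  [set x | D x /\ forall y, D y -> g x <= g y].

Definition stationary (R : realType) (k : scalar_kind) (n1 n2 : nat)
    (g : 'M[entries R k]_(n1, n2) -> R) (X : 'M[entries R k]_(n1, n2)) : Prop :=
  (0 <= limf_einf (fun Y => ((g Y - g X) / frob (Y - X))%:E) X^')%E.

(* Main.v *)
Require Import Defs.
From HB Require Import structures.
From mathcomp Require Import all_boot all_order all_algebra.
From mathcomp Require Import complex.
From mathcomp Require Import all_classical all_reals all_analysis.
From mathcomp Require Import ring lra.

(* Write c = 1 - delta_{2K}^- and Phi(X) = sum_i r_mu(sigma_i(X)) + |X|_F^2, a
   unitarily invariant function with sum g(sigma_i), where g(s) is 2 sqrt(mu) s
   below sqrt(mu) and mu + s^2 above.  Since g(s) is the minimum of
   mu beta^2 + gamma^2 over s <= beta gamma, beta <= 1, one has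
   Phi(BC) <= mu |B|^2 + |C|^2 for every contraction B, with equality for a
   factorization read off the SVD.  Perturbing that factorization linearly shows
   that if X is stationary then X and Z = X - A^*(AX - b) have a common SVD, with
   singular values (x, z) such that z = max(x, sqrt mu) or x = 0, z <= sqrt mu.
   A best rank K approximation XB satisfies the first-order conditions, so that
   XB and ZB have a common SVD too, and the assumptions on eps and sigma_K(X0)
   create a gap: z = x >= sqrt(mu) / c' or x = 0, z <= c' sqrt(mu), with c' < c.
   Expanding in singular vectors and using that the squared overlaps are doubly
   substochastic, a scalar inequality then yields
   <ZB - Z, XB - X> >= (1 - c') |XB - X|^2, whereas the left side equals
   |XB - X|^2 - |A(XB - X)|^2 <= (1 - c) |XB - X|^2 if rank X <= K; so X = XB.
   For the global minimizers, points of rank > K lose to XB by counting mu rank(X)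
   and points of rank < K by the Eckart-Young bound; finally, as |A| < 1, the
   regularized functional is strictly concave in each singular value on
   [0, sqrt mu], so all singular values can be pushed to 0 or beyond sqrt(mu),
   where both functionals agree. *)

Set Implicit Arguments.
Unset Strict Implicit.
Unset Printing Implicit Defensive.

Import Order.TTheory GRing.Theory Num.Theory.
Import numFieldNormedType.Exports.

Local Open Scope classical_set_scope.
Local Open Scope ring_scope.

(** * Real and complex scalars, Frobenius inner product *)

Section Scalars.
Variables (R : realType) (k : scalar_kind).
Local Notation F := (entries R k).

Definition cj : F -> F :=
  match k return entries R k -> entries R k with
  | RealScalars => fun x => x
  | ComplexScalars => fun z : R[i] => z^*%C
  end.

Definition ofR : R -> F :=
  match k return R -> entries R k with
  | RealScalars => fun x => x
  | ComplexScalars => fun x => x%:C%C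
  end.

Definition reE (x : F) : R := complex.Re (toC x).

Fact toC_zmod_morphism : zmod_morphism (@toC R k).
Proof. by rewrite /toC; case: k => x y //; rewrite rmorphB. Qed.
Fact toC_monoid_morphism : monoid_morphism (@toC R k).
Proof.
rewrite /toC; case: k; split=> [|x y] //=; rewrite ?rmorph1 ?rmorphM //.
Qed.
HB.instance Definition _ :=
  GRing.isZmodMorphism.Build F R[i] (@toC R k) toC_zmod_morphism.
HB.instance Definition _ :=
  GRing.isMonoidMorphism.Build F R[i] (@toC R k) toC_monoid_morphism.

Fact cj_zmod_morphism : zmod_morphism cj.
Proof. by rewrite /cj; case: k => x y //; rewrite rmorphB. Qed.
Fact cj_monoid_morphism : monoid_morphism cj.
Proof.
by rewrite /cj; case: k; split=> [|x y] //; rewrite (rmorph1, rmorphM).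
Qed.
HB.instance Definition _ := GRing.isZmodMorphism.Build F F cj cj_zmod_morphism.
HB.instance Definition _ :=
  GRing.isMonoidMorphism.Build F F cj cj_monoid_morphism.

Fact ofR_zmod_morphism : zmod_morphism ofR.
Proof. by rewrite /ofR; case: k => x y //; rewrite rmorphB. Qed.
Fact ofR_monoid_morphism : monoid_morphism ofR.
Proof.
rewrite /ofR; case: k; split=> [|x y] //=; rewrite ?rmorph1 ?rmorphM //.
Qed.
HB.instance Definition _ := GRing.isZmodMorphism.Build R F ofR ofR_zmod_morphism.
HB.instance Definition _ :=
  GRing.isMonoidMorphism.Build R F ofR ofR_monoid_morphism.

Fact reE_zmod_morphism : zmod_morphism reE.
Proof.
by move=> x y; rewrite /reE rmorphB /=; case: (toC x) => a b; case: (toC y).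
Qed.
HB.instance Definition _ :=
  GRing.isZmodMorphism.Build F R reE reE_zmod_morphism.

Lemma toC_inj : injective (@toC R k).
Proof. by rewrite /toC; case: k => [x y [] | x y]. Qed.

Lemma toC_cj x : toC (cj x) = (toC x)^*%C.
Proof. by move: x; rewrite /toC /cj; case: k => x //=; rewrite oppr0. Qed.

Lemma toC_ofR x : toC (ofR x) = x%:C%C.
Proof. by rewrite /toC /ofR; case: k. Qed.

Lemma cjK : involutive cj.
Proof. by move=> x; apply: toC_inj; rewrite !toC_cj conjcK. Qed.

Lemma cj_ofR x : cj (ofR x) = ofR x.
Proof. by apply: toC_inj; rewrite toC_cj toC_ofR conjc_real. Qed.

Lemma ofRK : cancel ofR reE.
Proof. by move=> x; rewrite /reE toC_ofR. Qed.

Lemma ofR_inj : injective ofR. Proof. exact: can_inj ofRK. Qed.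

Lemma reE_cj x : reE (cj x) = reE x.
Proof. by rewrite /reE toC_cj; case: (toC x). Qed.

Lemma reE_ofRM t x : reE (ofR t * x) = t * reE x.
Proof. by rewrite /reE rmorphM /= toC_ofR; case: (toC x) => a b /=; ring. Qed.

Lemma modulus_ge0 (x : F) : 0 <= modulus x.
Proof. by rewrite /modulus; case: (toC x) => a b /=; exact: sqrtr_ge0. Qed.

Lemma cj_mul (x : F) : cj x * x = ofR (modulus x ^+ 2).
Proof.
apply: toC_inj; rewrite rmorphM /= toC_cj toC_ofR /modulus.
case: (toC x) => a b /=; rewrite sqr_sqrtr ?addr_ge0 ?sqr_ge0 //.
by apply/eqP; rewrite eq_complex /=; apply/andP; split; apply/eqP; ring.
Qed.

Lemma reE_cj_mul (x : F) : reE (cj x * x) = modulus x ^+ 2.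
Proof. by rewrite cj_mul ofRK. Qed.

Lemma modulus_eq0 (x : F) : (modulus x == 0) = (x == 0).
Proof.
apply/eqP/eqP => [/ComplexField.Normc.eq0_normc x0|->].
  by apply: toC_inj; rewrite x0 rmorph0.
by rewrite /modulus rmorph0 ComplexField.Normc.normc0.
Qed.

Lemma modulusM (x y : F) : modulus (x * y) = modulus x * modulus y.
Proof. by rewrite /modulus rmorphM ComplexField.Normc.normcM. Qed.

Lemma modulus_cj (x : F) : modulus (cj x) = modulus x.
Proof.
apply/eqP; rewrite -(@eqrXn2 _ 2) ?modulus_ge0 //.
by apply/eqP/ofR_inj; rewrite -!cj_mul cjK mulrC.
Qed.

Lemma reE_le_modulus (x : F) : `|reE x| <= modulus x.
Proof.
rewrite /reE /modulus; case: (toC x) => a b /=.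
by rewrite -sqrtr_sqr ler_wsqrtr // lerDl sqr_ge0.
Qed.

End Scalars.

Notation "X ^H" := (map_mx (@cj _ _) X)^T (at level 8, format "X ^H") : ring_scope.

Section Frobenius.
Variables (R : realType) (k : scalar_kind).
Local Notation F := (entries R k).

Definition dg n (x : 'I_n -> R) : 'M[F]_n := diag_mx (\row_i @ofR R k (x i)).

(** The real part of the trace form makes the matrix space a real Hilbert space over both fields, so
    all first-order arguments can use real parameters. *)
Definition ip p q (X Y : 'M[F]_(p, q)) : R := reE (\tr (X^H *m Y)).

Lemma adjmxE p q (X : 'M[F]_(p, q)) i j : X^H i j = cj (X j i).
Proof. by rewrite !mxE. Qed.

Lemma adjmxK p q (X : 'M[F]_(p, q)) : X^H^H = X.
Proof. by apply/matrixP => i j; rewrite !adjmxE cjK. Qed.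

Lemma adjmxM p q r (X : 'M[F]_(p, q)) (Y : 'M[F]_(q, r)) : (X *m Y)^H = Y^H *m X^H.
Proof. by rewrite map_mxM trmx_mul. Qed.

Lemma adjmxD p q (X Y : 'M[F]_(p, q)) : (X + Y)^H = X^H + Y^H.
Proof. by rewrite map_mxD linearD. Qed.

Lemma adjmxN p q (X : 'M[F]_(p, q)) : (- X)^H = - X^H.
Proof. by rewrite map_mxN linearN. Qed.

Lemma adjmxZ p q t (X : 'M[F]_(p, q)) : (ofR k t *: X)^H = ofR k t *: X^H.
Proof. by rewrite map_mxZ linearZ /= cj_ofR. Qed.

Lemma adjmx0 p q : (0 : 'M[F]_(p, q))^H = 0.
Proof. by rewrite map_mx0 trmx0. Qed.

Lemma adjmx1 p : (1%:M : 'M[F]_p)^H = 1%:M.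
Proof. by rewrite map_mx1 trmx1. Qed.

Lemma adjmx_dg n (x : 'I_n -> R) : (dg x)^H = dg x.
Proof.
rewrite /dg map_diag_mx tr_diag_mx; congr diag_mx.
by apply/rowP => i; rewrite !mxE /= cj_ofR.
Qed.

Lemma dg_mul n (x y : 'I_n -> R) : dg x *m dg y = dg (fun i => x i * y i).
Proof.
rewrite /dg mulmx_diag; congr diag_mx.
by apply/rowP => i; rewrite !mxE rmorphM.
Qed.

Lemma dgE n (x : 'I_n -> R) i j : dg x i j = ofR k (x i) *+ (i == j).
Proof. by rewrite !mxE. Qed.

Lemma dg1 n : dg (fun _ : 'I_n => 1) = 1%:M.
Proof. by apply/matrixP => i j; rewrite dgE rmorph1 mxE. Qed.

Lemma mul_dgE n p (x : 'I_n -> R) (X : 'M[F]_(n, p)) i j :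
  (dg x *m X) i j = ofR k (x i) * X i j.
Proof. by rewrite mul_diag_mx !mxE. Qed.

Lemma mulmx_dgE n p (x : 'I_n -> R) (X : 'M[F]_(p, n)) i j :
  (X *m dg x) i j = X i j * ofR k (x j).
Proof. by rewrite mul_mx_diag !mxE. Qed.

Lemma ipE p q (X Y : 'M[F]_(p, q)) :
  ip X Y = \sum_(i < p) \sum_(j < q) reE (cj (X i j) * Y i j).
Proof.
rewrite /ip /mxtrace raddf_sum exchange_big /=; apply: eq_bigr => j _.
rewrite mxE raddf_sum /=; apply: eq_bigr => i _.
by rewrite adjmxE.
Qed.

Lemma ipC p q (X Y : 'M[F]_(p, q)) : ip X Y = ip Y X.
Proof.
rewrite !ipE; apply: eq_bigr => i _; apply: eq_bigr => j _.
by rewrite -reE_cj rmorphM /= cjK mulrC.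
Qed.

Lemma ipDl p q (X Y Z : 'M[F]_(p, q)) : ip (X + Y) Z = ip X Z + ip Y Z.
Proof. by rewrite /ip adjmxD mulmxDl mxtraceD raddfD. Qed.
Lemma ipDr p q (X Y Z : 'M[F]_(p, q)) : ip Z (X + Y) = ip Z X + ip Z Y.
Proof. by rewrite ipC ipDl !(ipC Z). Qed.
Lemma ipNl p q (X Y : 'M[F]_(p, q)) : ip (- X) Y = - ip X Y.
Proof. by rewrite /ip adjmxN mulNmx !raddfN. Qed.
Lemma ipNr p q (X Y : 'M[F]_(p, q)) : ip X (- Y) = - ip X Y.
Proof. by rewrite ipC ipNl ipC. Qed.
Lemma ipBl p q (X Y Z : 'M[F]_(p, q)) : ip (X - Y) Z = ip X Z - ip Y Z.
Proof. by rewrite ipDl ipNl. Qed.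
Lemma ipBr p q (X Y Z : 'M[F]_(p, q)) : ip Z (X - Y) = ip Z X - ip Z Y.
Proof. by rewrite ipDr ipNr. Qed.
Lemma ipZl p q t (X Y : 'M[F]_(p, q)) : ip (ofR k t *: X) Y = t * ip X Y.
Proof. by rewrite /ip adjmxZ -scalemxAl linearZ /= reE_ofRM. Qed.
Lemma ipZr p q t (X Y : 'M[F]_(p, q)) : ip X (ofR k t *: Y) = t * ip X Y.
Proof. by rewrite ipC ipZl ipC. Qed.
Lemma ip0l p q (X : 'M[F]_(p, q)) : ip 0 X = 0.
Proof. by rewrite /ip adjmx0 mul0mx mxtrace0 raddf0. Qed.
Lemma ip0r p q (X : 'M[F]_(p, q)) : ip X 0 = 0.
Proof. by rewrite ipC ip0l. Qed.

Lemma ip_mull p q r (U : 'M[F]_(p, q)) (X : 'M[F]_(q, r)) Y :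
  ip (U *m X) Y = ip X (U^H *m Y).
Proof. by rewrite /ip adjmxM mulmxA. Qed.

Lemma ip_mulr p q r (X : 'M[F]_(p, q)) (V : 'M[F]_(q, r)) Y :
  ip (X *m V) Y = ip X (Y *m V^H).
Proof. by rewrite /ip adjmxM -mulmxA mxtrace_mulC mulmxA. Qed.

Lemma ip_adj p q (X Y : 'M[F]_(p, q)) : ip X^H Y^H = ip X Y.
Proof.
rewrite !ipE exchange_big /=; apply: eq_bigr => i _; apply: eq_bigr => j _.
by rewrite !adjmxE -reE_cj rmorphM /= !cjK.
Qed.

Lemma ip_norm p q (X : 'M[F]_(p, q)) :
  ip X X = \sum_(i < p) \sum_(j < q) modulus (X i j) ^+ 2.
Proof.
by rewrite ipE; apply: eq_bigr => i _; apply: eq_bigr => j _; rewrite reE_cj_mul.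
Qed.

Lemma ip_ge0 p q (X : 'M[F]_(p, q)) : 0 <= ip X X.
Proof.
by rewrite ip_norm; do 2 (apply: sumr_ge0 => ? _); rewrite exprn_ge0 // modulus_ge0.
Qed.

Lemma frob_sqr p q (X : 'M[F]_(p, q)) : frob X ^+ 2 = ip X X.
Proof. by rewrite /frob -ip_norm sqr_sqrtr // ip_ge0. Qed.

Lemma frobE p q (X : 'M[F]_(p, q)) : frob X = Num.sqrt (ip X X).
Proof. by rewrite ip_norm. Qed.

Lemma frob_ge0 p q (X : 'M[F]_(p, q)) : 0 <= frob X.
Proof. exact: sqrtr_ge0. Qed.

Lemma frob_eq0 p q (X : 'M[F]_(p, q)) : (frob X == 0) = (X == 0).
Proof.
apply/eqP/eqP => [X0|->]; last by rewrite frobE ip0l sqrtr0.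
have : ip X X = 0 by rewrite -frob_sqr X0 expr0n.
rewrite ip_norm => /eqP; rewrite psumr_eq0; last first.
  by move=> i _; apply: sumr_ge0 => j _; rewrite exprn_ge0 ?modulus_ge0.
move=> /allP H; apply/matrixP => i j; rewrite mxE.
have := H i (mem_index_enum _); rewrite implyTb psumr_eq0; last first.
  by move=> ? _; rewrite exprn_ge0 ?modulus_ge0.
move=> /allP /(_ j (mem_index_enum _)); rewrite implyTb expf_eq0 /= modulus_eq0.
by move=> /eqP.
Qed.

Lemma frob0 p q : frob (0 : 'M[F]_(p, q)) = 0.
Proof. by apply/eqP; rewrite frob_eq0. Qed.

Lemma ip_eq0 p q (X : 'M[F]_(p, q)) : ip X X = 0 -> X = 0.
Proof.
by move=> h; apply/eqP; rewrite -frob_eq0 -sqrf_eq0 frob_sqr h.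
Qed.

Lemma frobN p q (X : 'M[F]_(p, q)) : frob (- X) = frob X.
Proof. by rewrite !frobE ipNl ipNr opprK. Qed.

Lemma frobC p q (X Y : 'M[F]_(p, q)) : frob (X - Y) = frob (Y - X).
Proof. by rewrite -frobN opprB. Qed.

Lemma frobZ p q t (X : 'M[F]_(p, q)) : frob (ofR k t *: X) = `|t| * frob X.
Proof.
by rewrite !frobE ipZl ipZr mulrA -expr2 sqrtrM ?sqr_ge0 // sqrtr_sqr.
Qed.

Lemma frob_adj p q (X : 'M[F]_(p, q)) : frob X^H = frob X.
Proof. by rewrite !frobE ip_adj. Qed.

Lemma frob_sqrD p q (X Y : 'M[F]_(p, q)) :
  frob (X + Y) ^+ 2 = frob X ^+ 2 + 2 * ip X Y + frob Y ^+ 2.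
Proof. by rewrite !frob_sqr ipDl !ipDr (ipC Y X); ring. Qed.

Lemma frob_sqrB p q (X Y : 'M[F]_(p, q)) :
  frob (X - Y) ^+ 2 = frob X ^+ 2 - 2 * ip X Y + frob Y ^+ 2.
Proof. by rewrite frob_sqrD ipNr frobN; ring. Qed.

Lemma cauchy_schwarz p q (X Y : 'M[F]_(p, q)) : ip X Y <= frob X * frob Y.
Proof.
have [->|Y0] := eqVneq Y 0; first by rewrite ip0r frob0 mulr0.
have y0 : 0 < frob Y by rewrite lt_neqAle frob_ge0 eq_sym frob_eq0 Y0.
have [->|X0] := eqVneq X 0; first by rewrite ip0l frob0 mul0r.
have x0 : 0 < frob X by rewrite lt_neqAle frob_ge0 eq_sym frob_eq0 X0.
(* With x = |X|, y = |Y|, a = <X, Y>, the square of |y X - x Y| is 2 x y (x y - a). *)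
have := ip_ge0 (ofR k (frob Y) *: X - ofR k (frob X) *: Y).
rewrite ipBl !ipBr !ipZl !ipZr -!frob_sqr (ipC Y X).
set x := frob X; set y := frob Y; set a := ip X Y => h.
have xy : 0 < x * y by rewrite mulr_gt0.
rewrite -(ler_pM2l xy) -subr_ge0.
rewrite (_ : _ - _ = (y * (y * x ^+ 2) - y * (x * a) - (x * (y * a) -
  x * (x * y ^+ 2))) / 2); last by field.
by rewrite divr_ge0.
Qed.

Lemma frobD p q (X Y : 'M[F]_(p, q)) : frob (X + Y) <= frob X + frob Y.
Proof.
rewrite -(@ler_pXn2r _ 2) ?nnegrE ?addr_ge0 ?frob_ge0 //.
by rewrite frob_sqrD sqrrD; have := cauchy_schwarz X Y; lra.
Qed.

Lemma frobB p q (X Y : 'M[F]_(p, q)) : frob X - frob Y <= frob (X - Y).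
Proof. by rewrite lerBlDr -{1}(subrK Y X) frobD. Qed.

Lemma frob_isom p q r (U : 'M[F]_(p, q)) (X : 'M[F]_(q, r)) :
  U^H *m U = 1%:M -> frob (U *m X) = frob X.
Proof. by move=> UU; rewrite !frobE ip_mull mulmxA UU mul1mx. Qed.

Lemma frob_isom_adj p q r (V : 'M[F]_(q, r)) (X : 'M[F]_(p, r)) :
  V^H *m V = 1%:M -> frob (X *m V^H) = frob X.
Proof. by move=> VV; rewrite !frobE ip_mulr adjmxK -mulmxA VV mulmx1. Qed.

(** U U^H is an orthogonal projection: the square of |X - U U^H X| expands to |X|^2 - |U^H X|^2. *)
Lemma frob_coisom p q r (U : 'M[F]_(p, q)) (X : 'M[F]_(p, r)) :
  U^H *m U = 1%:M -> frob (U^H *m X) <= frob X.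
Proof.
move=> UU; rewrite -(@ler_pXn2r _ 2) ?nnegrE ?frob_ge0 //.
have := ip_ge0 (X - U *m (U^H *m X)).
rewrite -!frob_sqr frob_sqrB frob_isom // (ipC X) ip_mull -frob_sqr.
lra.
Qed.

Lemma frob_coisom_r p q r (V : 'M[F]_(q, r)) (X : 'M[F]_(p, q)) :
  V^H *m V = 1%:M -> frob (X *m V) <= frob X.
Proof.
by move=> VV; rewrite -frob_adj adjmxM -(frob_adj X); exact: frob_coisom.
Qed.

Lemma frob_sqr_isom p q (U : 'M[F]_(p, q)) : U^H *m U = 1%:M ->
  frob U ^+ 2 = q%:R.
Proof.
by move=> UU; rewrite frob_sqr /ip UU mxtrace1 -(rmorph_nat (@ofR R k)) ofRK.
Qed.

Lemma frob_dg n (x : 'I_n -> R) : frob (dg x) ^+ 2 = \sum_i x i ^+ 2.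
Proof.
rewrite frob_sqr /ip adjmx_dg dg_mul /dg mxtrace_diag raddf_sum /=.
by apply: eq_bigr => i _; rewrite mxE ofRK expr2.
Qed.

End Frobenius.

Arguments dg {R} k {n} x.

(** * Singular value decomposition *)

(** Sylvester's identity. The determinant of (X, a; b, 1) is found by two block eliminations:
    clearing a leaves X - ba, clearing b leaves X - ab. *)
Lemma char_poly_mulC (K : comNzRingType) q r (A : 'M[K]_(q, r)) (B : 'M[K]_(r, q)) :
  char_poly (A *m B) * 'X^r = 'X^q * char_poly (B *m A).
Proof.
pose a := map_mx polyC A; pose b := map_mx polyC B.
have /(congr1 determinant) : block_mx 'X%:M a b 1%:M *m
    block_mx 1%:M (- a) 0 'X%:M = block_mx 'X%:M 0 b ('X%:M - b *m a).
  rewrite mulmx_block !mulmx1 !mulmx0 !addr0 mul1mx !mulmxN.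
  by rewrite scalar_mxC addNr addrC.
rewrite det_mulmx det_ublock det1 mul1r det_lblock !det_scalar.
have -> : \det (block_mx 'X%:M a b 1%:M) = char_poly (A *m B).
  have /(congr1 determinant) : block_mx 'X%:M a b 1%:M *m
      block_mx 1%:M 0 (- b) 1%:M = block_mx ('X%:M - a *m b) a 0 1%:M.
    by rewrite mulmx_block !mulmx1 !mulmx0 !add0r mul1mx !mulmxN subrr.
  rewrite det_mulmx det_lblock !det1 !mulr1 det_ublock det1 mulr1 => ->.
  by rewrite /char_poly /char_poly_mx map_mxM.
by rewrite /char_poly /char_poly_mx !map_mxM => ->.
Qed.

Section SVD.
Variables (R : realType) (k : scalar_kind).
Local Notation F := (entries R k).

(** The columns of U are orthonormal; for a single column this says that it is a unit vector. *)
Definition isom p q (U : 'M[F]_(p, q)) := U^H *m U = 1%:M.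

Definition catf r1 r2 (s1 : 'I_r1 -> R) (s2 : 'I_r2 -> R) (i : 'I_(r1 + r2)) : R :=
  match fintype.split i with inl j => s1 j | inr j => s2 j end.

Lemma catf_l r1 r2 (s1 : 'I_r1 -> R) (s2 : 'I_r2 -> R) i :
  catf s1 s2 (lshift r2 i) = s1 i.
Proof. by rewrite /catf (unsplitK (inl i)). Qed.

Lemma catf_r r1 r2 (s1 : 'I_r1 -> R) (s2 : 'I_r2 -> R) i :
  catf s1 s2 (rshift r1 i) = s2 i.
Proof. by rewrite /catf (unsplitK (inr i)). Qed.

Lemma dg_catf r1 r2 (s1 : 'I_r1 -> R) (s2 : 'I_r2 -> R) :
  dg k (catf s1 s2) = block_mx (dg k s1) 0 0 (dg k s2).
Proof.
rewrite /dg -diag_mx_row; congr diag_mx; apply/rowP => i.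
by rewrite !mxE /catf; case: fintype.splitP => j _; rewrite mxE.
Qed.

Lemma adjmx_row p r1 r2 (U1 : 'M[F]_(p, r1)) (U2 : 'M[F]_(p, r2)) :
  (row_mx U1 U2)^H = col_mx U1^H U2^H.
Proof. by rewrite map_row_mx tr_row_mx. Qed.

Lemma isom_row p r1 r2 (U1 : 'M[F]_(p, r1)) (U2 : 'M[F]_(p, r2)) :
  isom U1 -> isom U2 -> U1^H *m U2 = 0 -> isom (row_mx U1 U2).
Proof.
move=> h1 h2 h; rewrite /isom adjmx_row mul_col_row h1 h2 h.
have -> : U2^H *m U1 = 0 by rewrite -[LHS]adjmxK adjmxM adjmxK h adjmx0.
by rewrite scalar_mx_block.
Qed.

Lemma row_dg_adj p q r1 r2 (U1 : 'M[F]_(p, r1)) (U2 : 'M[F]_(p, r2))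
    (V1 : 'M[F]_(q, r1)) (V2 : 'M[F]_(q, r2)) s1 s2 :
  row_mx U1 U2 *m dg k (catf s1 s2) *m (row_mx V1 V2)^H =
  U1 *m dg k s1 *m V1^H + U2 *m dg k s2 *m V2^H.
Proof.
rewrite adjmx_row dg_catf mul_row_block !mulmx0 addr0 add0r mul_row_col //.
Qed.

Lemma isom_rank p q (U : 'M[F]_(p, q)) : isom U -> \rank U = q.
Proof.
move=> h; apply/eqP; rewrite eqn_leq rank_leq_col /=.
by rewrite -[X in (X <= _)%N](mxrank1 F q) -h mxrankM_maxr.
Qed.

Lemma isom_le p q (U : 'M[F]_(p, q)) : isom U -> (q <= p)%N.
Proof. by move/isom_rank <-; exact: rank_leq_row. Qed.

Lemma mulmx_isom_inj p q r (V : 'M[F]_(p, q)) (A B : 'M[F]_(r, q)) : isom V ->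
  A *m V^H = B *m V^H -> A = B.
Proof.
by move=> h /(congr1 (mulmx^~ V)); rewrite -!mulmxA h !mulmx1.
Qed.

Lemma isom_mulmx_inj p q r (U : 'M[F]_(p, q)) (A B : 'M[F]_(q, r)) : isom U ->
  U *m A = U *m B -> A = B.
Proof.
by move=> h /(congr1 (mulmx U^H)); rewrite !mulmxA h !mul1mx.
Qed.

Lemma dg_unit n (x : 'I_n -> R) : (forall i, x i != 0) -> dg k x \in unitmx.
Proof.
move=> x0; have : dg k x *m dg k (fun i => (x i)^-1) = 1%:M.
  rewrite dg_mul -dg1; congr dg; apply/funext => i; exact: divff.
by move/mulmx1_unit => [].
Qed.

(** No sign or order is imposed on [s]; lemmas that need nonnegative or positive values assume so
    separately. *)
Definition is_svd p q r (X : 'M[F]_(p, q)) (U : 'M[F]_(p, r)) (s : 'I_r -> R)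
    (V : 'M[F]_(q, r)) :=
  [/\ isom U, isom V & X = U *m dg k s *m V^H].

Lemma svd_cat p q r1 r2 (X1 X2 : 'M[F]_(p, q)) (U1 : 'M[F]_(p, r1)) s1 V1
    (U2 : 'M[F]_(p, r2)) s2 V2 :
  is_svd X1 U1 s1 V1 -> is_svd X2 U2 s2 V2 -> U1^H *m U2 = 0 -> V1^H *m V2 = 0 ->
  is_svd (X1 + X2) (row_mx U1 U2) (catf s1 s2) (row_mx V1 V2).
Proof.
move=> [hU1 hV1 ->] [hU2 hV2 ->] hU hV; split; try exact: isom_row.
by rewrite row_dg_adj.
Qed.

Lemma svd_rank p q r (X : 'M[F]_(p, q)) (U : 'M[F]_(p, r)) s V :
  is_svd X U s V -> (forall i, s i != 0) -> \rank X = r.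
Proof.
move=> [hU hV ->] s0; apply/eqP; rewrite eqn_leq; apply/andP; split.
  by rewrite -mulmxA (leq_trans (mxrankM_maxl _ _)) // rank_leq_col.
have rs : \rank (dg k s) = r by rewrite mxrank_unit // dg_unit.
rewrite -{1}rs; have {1}-> : dg k s = U^H *m (U *m dg k s *m V^H) *m V.
  by rewrite !mulmxA hU mul1mx -mulmxA hV mulmx1.
by rewrite (leq_trans (mxrankM_maxl _ _)) // mxrankM_maxr.
Qed.

(** The spectral theorem is applied to the complexified matrix. Its nonzero eigenvalue is real,
    hence comes from F, and being an eigenvalue descends along the field embedding [toC]. *)
Lemma hermitian_eigen n (S : 'M[F]_n) : S^H = S -> S != 0 ->
  exists (l : R) (v : 'cV[F]_n), [/\ l != 0, v != 0 & S *m v = ofR k l *: v].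
Proof.
move=> Sh S0; pose SC := map_mx (@toC R k) S.
have SCh : SC \is hermsymmx.
  apply/is_hermitianmxP; rewrite expr0 scale1r /SC -{1}Sh.
  by apply/matrixP => i j; rewrite !mxE toC_cj.
have /hermitian_normalmx /orthomx_spectralP SCE := SCh.
have := hermitian_spectral_diag_real SCh.
set P := spectralmx SC in SCE *; set d := spectral_diag SC in SCE * => dreal.
have [j dj] : exists j, d 0 j != 0.
  apply/existsP; apply: contraT; rewrite negb_exists => /forallP d0.
  move: SCE; have -> : d = 0.
    by apply/rowP => j; rewrite mxE; apply/eqP; have := d0 j; rewrite negbK.
  rewrite (_ : diag_mx 0 = 0); last first.
    by apply/matrixP => i j; rewrite !mxE mul0rn.
  rewrite mulmx0 mul0mx => SC0; case/negP: S0; apply/eqP/matrixP => i j.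
  by apply: (@toC_inj R k); move/matrixP/(_ i j): SC0; rewrite !mxE rmorph0.
have /complex_realP [l dl] : d 0 j \is Num.real.
  by move/mxOverP: dreal; apply.
have : eigenvalue SC (d 0 j).
  apply/eigenvalueP; exists (row j P); last first.
    by apply: contraNneq dj => rP; have := @row_free_unit _ _ P;
      rewrite spectral_unit => /row_freeP [B /(congr1 (row j))];
      rewrite row_mul rP mul0mx => /rowP /(_ j); rewrite !mxE eqxx => /eqP;
      rewrite eq_sym oner_eq0.
  rewrite -row_mul {1}SCE -mulmxA mulKVmx ?spectral_unit //.
  by rewrite row_mul row_diag_mx -scalemxAl -rowE.
rewrite dl -(toC_ofR k) eigenvalue_map => /eigenvalueP [w wS w0].
(* [eigenvalue] yields a row vector; as S is Hermitian, its adjoint is a column eigenvector. *)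
exists l, (w^H); split.
- by apply: contraNneq dj => l0; rewrite dl l0.
- by apply: contraNneq w0 => w0; apply/eqP; rewrite -[w]adjmxK w0 adjmx0.
- by rewrite -{1}Sh -adjmxM wS adjmxZ.
Qed.

Lemma col_gram p (x : 'cV[F]_p) : x^H *m x = (ofR k (ip x x))%:M.
Proof.
rewrite [LHS]mx11_scalar; congr scalar_mx; rewrite mxE ipE rmorph_sum.
apply: eq_bigr => i _; rewrite big_ord1 adjmxE cj_mul ofRK //.
Qed.

(** v is a unit eigenvector of X^H X, s the square root of its eigenvalue, and u = X v / s. *)
Lemma singular_pair p q (X : 'M[F]_(p, q)) : X != 0 ->
  exists (s : R) (u : 'cV[F]_p) (v : 'cV[F]_q),
    [/\ 0 < s, isom u, isom v, X *m v = ofR k s *: u & X^H *m u = ofR k s *: v].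
Proof.
move=> X0; have [||l [v [l0 v0 Sv]]] := @hermitian_eigen _ (X^H *m X).
- by rewrite adjmxM adjmxK.
- apply: contraNneq X0 => XX; apply/eqP; apply: ip_eq0.
  by rewrite /ip XX mxtrace0 raddf0.
have n0 : 0 < frob v by rewrite lt_neqAle frob_ge0 eq_sym frob_eq0 v0.
have lE : frob (X *m v) ^+ 2 = l * frob v ^+ 2.
  by rewrite !frob_sqr ip_mull mulmxA Sv ipZr.
have lpos : 0 < l.
  rewrite lt_neqAle eq_sym l0 -(@pmulr_lge0 _ (frob v ^+ 2)) ?exprn_gt0 //.
  by rewrite -lE sqr_ge0.
pose w : 'cV[F]_q := ofR k (frob v)^-1 *: v.
have ww : ip w w = 1.
  by rewrite ipZl ipZr -frob_sqr; field; rewrite gt_eqF.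
have Sw : X^H *m X *m w = ofR k l *: w.
  by rewrite -scalemxAr Sv !scalerA mulrC.
exists (Num.sqrt l), (ofR k (Num.sqrt l)^-1 *: (X *m w)), w.
have sl0 : 0 < Num.sqrt l by rewrite sqrtr_gt0.
have ll : Num.sqrt l ^+ 2 = l by rewrite sqr_sqrtr // ltW.
split=> //.
- rewrite /isom col_gram ipZl ipZr ip_mull mulmxA Sw ipZr ww mulr1.
  rewrite -{3}ll (_ : _ * _ = 1) ?rmorph1 //.
  by field; rewrite gt_eqF.
- by rewrite /isom col_gram ww rmorph1.
- by rewrite scalerA -rmorphM divff ?gt_eqF // rmorph1 scale1r.
- rewrite -scalemxAr mulmxA Sw scalerA -rmorphM; congr (ofR k _ *: _).
  by rewrite -{2}ll; field; rewrite gt_eqF.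
Qed.

(** Induction on the rank by deflation: Y = X - s u v^H satisfies Y v = 0 and u^H Y = 0, so the
    singular vectors of Y are orthogonal to u and v. *)
Lemma svd_exists p q (X : 'M[F]_(p, q)) :
  exists (r : nat) (U : 'M[F]_(p, r)) (s : 'I_r -> R) (V : 'M[F]_(q, r)),
    is_svd X U s V /\ forall i, 0 < s i.
Proof.
have [n] := ubnP (\rank X); elim: n X => // n IH X.
have [->|X0] := eqVneq X 0.
  move=> _; exists 0%N, 0, (fun=> 0), 0; split; last by case.
  split; try by apply/matrixP => -[].
  by rewrite mul0mx mul0mx.
move=> rX; have [s [u [v [s0 hu hv Xv Xu]]]] := singular_pair X0.
pose Y := X - u *m dg k (fun _ : 'I_1 => s) *m v^H.
have dg1s : dg k (fun _ : 'I_1 => s) = (ofR k s)%:M.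
  by apply/matrixP => i j; rewrite dgE mxE.
have YE : Y = X - ofR k s *: (u *m v^H).
  by rewrite /Y dg1s mul_mx_scalar -scalemxAl.
have Yv : Y *m v = 0.
  by rewrite YE mulmxBl -scalemxAl -mulmxA hv mulmx1 Xv subrr.
have uY : u^H *m Y = 0.
  rewrite YE mulmxBr -scalemxAr mulmxA hu mul1mx -[u^H *m X]adjmxK adjmxM adjmxK Xu.
  by rewrite adjmxZ subrr.
have YX : (Y <= X)%MS.
  rewrite YE addmx_sub // eqmx_opp; apply: scalemx_sub.
  apply: (submx_trans (submxMl _ _)).
  have : ofR k s *: v^H = u^H *m X.
    by rewrite -[u^H *m X]adjmxK adjmxM adjmxK Xu adjmxZ.
  move/(congr1 (fun z => ofR k s^-1 *: z)).
  rewrite scalerA -rmorphM mulVf ?gt_eqF // rmorph1 scale1r => ->.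
  by apply: scalemx_sub; exact: submxMl.
(* The row space of Y lies in that of X, and equality would give X v = 0. *)
have rY : (\rank Y < \rank X)%N.
  rewrite ltn_neqAle mxrankS // andbT; apply/negP => /eqP rYX.
  have /andP [_ /submxP [D XD]] : (Y == X)%MS.
    by rewrite -(geq_leqif (mxrank_leqif_eq YX)) rYX.
  have : X *m v = 0 by rewrite XD -mulmxA Yv mulmx0.
  rewrite Xv => /eqP; rewrite scaler_eq0 => /orP [/eqP|/eqP u0].
    by rewrite -(rmorph0 (@ofR R k)) => /ofR_inj s00; rewrite s00 ltxx in s0.
  have /matrixP /(_ 0 0) := hu; rewrite u0 mulmx0 !mxE /= => /eqP.
  by rewrite eq_sym oner_eq0.
have [|r [U [t [V [[hU hV YE'] t0]]]]] := IH Y; first by apply: leq_trans rY _.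
have tu : dg k t \in unitmx by apply: dg_unit => i; rewrite gt_eqF.
have uU : u^H *m U = 0.
  move: uY; rewrite YE' !mulmxA => /eqP; rewrite -(mul0mx _ (V^H)) => /eqP.
  move/(mulmx_isom_inj hV) /(congr1 (mulmx^~ (invmx (dg k t)))).
  by rewrite mulmxK // mul0mx.
have vV : v^H *m V = 0.
  move: Yv; rewrite YE' -!mulmxA => /eqP; rewrite -(mulmx0 _ U) => /eqP.
  move/(isom_mulmx_inj hU) /(congr1 (mulmx (invmx (dg k t)))).
  rewrite mulKmx // mulmx0 => h.
  by rewrite -[LHS]adjmxK adjmxM adjmxK h adjmx0.
exists (1 + r)%N, (row_mx u U), (catf (fun=> s) t), (row_mx v V); split.
  have -> : X = u *m dg k (fun _ : 'I_1 => s) *m v^H + Y by rewrite addrC subrK.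
  exact: svd_cat.
by move=> i; rewrite /catf; case: fintype.split.
Qed.

End SVD.

(** * The singular values of the definition *)

Section Sigma.
Local Open Scope sesquilinear_scope.
Variables (R : realType) (k : scalar_kind).
Local Notation F := (entries R k).

Lemma char_poly_spectral (C : numClosedFieldType) n (S : 'M[C]_n) :
  S \is normalmx -> char_poly S = \prod_(j < n) ('X - (spectral_diag S 0 j)%:P).
Proof.
move=> /orthomx_spectralP SE; rewrite {1}SE -mulmxA.
have := char_poly_mulC (invmx (spectralmx S)) (diag_mx (spectral_diag S) *m spectralmx S).
rewrite -(mulmxA _ (spectralmx S)) mulmxV ?spectral_unit // mulmx1 mulrC.
move=> /(mulfI _) -> ; last by rewrite expf_neq0 // polyX_eq0.
rewrite char_poly_trig ?diag_mx_is_trig //.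
by apply: eq_bigr => i _; rewrite mxE eqxx.
Qed.

Lemma prod_nseq0 (K : comNzRingType) n :
  \prod_(x <- nseq n (0 : K)) ('X - x%:P) = 'X^n.
Proof.
rewrite big_nseq subr0; elim: n => [|n IH] /=; first by rewrite expr0.
by rewrite IH exprS.
Qed.

(** X^H X = V diag(s^2) V^H, so Sylvester's identity determines its characteristic polynomial.
    Unique factorization into linear factors identifies the spectrum as a multiset, and square roots
    are taken afterwards. *)
Lemma singular_values_perm p q r (X : 'M[F]_(p, q)) (U : 'M[F]_(p, r)) s V :
  is_svd X U s V -> (forall i, 0 <= s i) ->
  perm_eq (singular_values X) ([seq s i | i <- enum 'I_r] ++ nseq (q - r) 0).
Proof.
move=> [hU hV XE] s0; have rq := isom_le hV.
rewrite /singular_values; set XC := map_mx _ X; set S := XC ^t* *m XC.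
rewrite perm_sort.
have adjC a b (M : 'M[F]_(a, b)) : map_mx (@toC R k) (M^H) = (map_mx (@toC R k) M) ^t*.
  by apply/matrixP => i j; rewrite !mxE toC_cj.
have SE : S = map_mx (@toC R k) V *m
    (map_mx (@toC R k) (dg k (fun i => s i ^+ 2)) *m map_mx (@toC R k) V^H).
  rewrite /S /XC -adjC -!map_mxM; congr map_mx.
  rewrite XE !adjmxM adjmxK adjmx_dg !mulmxA -(mulmxA _ _ U) hU mulmx1.
  by rewrite -(mulmxA V) dg_mul; congr (_ *m dg k _ *m _); apply/funext => i;
    rewrite expr2.
have Snormal : S \is normalmx.
  apply: hermitian_normalmx; apply/is_hermitianmxP; rewrite expr0 scale1r.
  by rewrite /S trmx_mul map_mxM trmxCK.
have D2 : map_mx (@toC R k) (dg k (fun i => s i ^+ 2)) =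
   diag_mx (\row_i (s i ^+ 2)%:C%C).
  rewrite /dg map_diag_mx; congr diag_mx; apply/rowP => i.
  by rewrite !mxE /= toC_ofR.
have := char_poly_mulC (map_mx (@toC R k) V)
  (map_mx (@toC R k) (dg k (fun i => s i ^+ 2)) *m map_mx (@toC R k) V^H).
rewrite -SE -mulmxA -(map_mxM _ V^H) hV map_mx1 mulmx1 char_poly_spectral //.
rewrite D2 char_poly_trig ?diag_mx_is_trig //.
rewrite -!prod_nseq0.
set L := (L in L * _); set D := (D in _ = _ * D).
have -> : L = \prod_(x <- [seq spectral_diag S 0 j | j <- enum 'I_q]) ('X - x%:P).
  by rewrite /L big_map big_enum /=.
have -> : D = \prod_(x <- [seq (s i ^+ 2)%:C%C | i <- enum 'I_r]) ('X - x%:P).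
  by rewrite /D big_map big_enum /=; apply: eq_bigr => i _; rewrite !mxE eqxx.
rewrite -!big_cat => /prod_XsubC_eq.
(* The common factor X^r is cancelled, which leaves q - r zero eigenvalues. *)
have -> : nseq q (0 : R[i]) = nseq r 0 ++ nseq (q - r) 0 by rewrite -nseqD subnKC.
rewrite perm_catC -catA perm_cat2l.
pose g (z : R[i]) : R := Num.sqrt (complex.Re z).
have -> : [seq s i | i <- enum 'I_r] = map g [seq (s i ^+ 2)%:C%C | i <- enum 'I_r].
  by rewrite -[RHS]map_comp; apply: eq_map => i; rewrite /= /g /= sqrtr_sqr ger0_norm.
move=> /(perm_map g); rewrite map_cat map_nseq {2}/g /= sqrtr0.
rewrite -[X in perm_eq X _]map_comp.
by rewrite perm_sym perm_catC perm_sym.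
Qed.

Lemma singular_valuesE p q r (X : 'M[F]_(p, q)) (U : 'M[F]_(p, r)) s V :
  is_svd X U s V -> (forall i, 0 <= s i) ->
  singular_values X =
  sort (fun a b => b <= a) [seq s i | i <- enum 'I_r] ++ nseq (q - r) 0.
Proof.
move=> hX s0; have hp := singular_values_perm hX s0.
have tot : total (fun a b : R => b <= a) by move=> a b; exact: le_total.
have tr : transitive (fun a b : R => b <= a) by move=> a b c h1 h2; exact: le_trans h2 h1.
have asym : antisymmetric (fun a b : R => b <= a).
  by move=> a b /andP [h1 h2]; apply/eqP; rewrite eq_le h1 h2.
apply: (sorted_eq tr asym).
- exact: sort_sorted.
- rewrite (sorted_pairwise tr) pairwise_cat -!(sorted_pairwise tr) sort_sorted //=.
  apply/andP; split; last first.
    rewrite (sorted_pairwise tr); elim: (_ - _)%N => //= n ->.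
    by rewrite andbT all_nseq lexx orbT.
  apply/allrelP => x y; rewrite mem_sort => /mapP [i _ ->] /nseqP [-> _].
  exact: s0.
- by apply: perm_trans hp _; rewrite perm_cat2r perm_sym perm_sort.
Qed.

(** Lets a sum over singular values be read off an SVD of any length: r is at most min(p, q), and
    the padding zeros contribute f 0 = 0. *)
Lemma sum_sigma p q r (X : 'M[F]_(p, q)) (U : 'M[F]_(p, r)) s V (f : R -> R) :
  is_svd X U s V -> (forall i, 0 <= s i) -> f 0 = 0 ->
  \sum_(i < minn p q) f (sigma X i) = \sum_(i < r) f (s i).
Proof.
move=> hX s0 f0; have [hU hV _] := hX.
have rle : (r <= minn p q)%N by rewrite leq_min (isom_le hU) (isom_le hV).
rewrite -(big_mkord xpredT (fun i => f (sigma X i))) (big_cat_nat (n := r)) //=.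
rewrite [X in _ + X]big1_seq => [|i /andP [_]]; last first.
  rewrite mem_index_iota => /andP [ri _]; rewrite /sigma (singular_valuesE hX s0).
  rewrite nth_cat size_sort size_map size_enum_ord ltnNge ri /= nth_nseq.
  by case: ifP.
rewrite addr0 -(big_enum _ _ _ (fun i => f (s i))) /= -(big_map s xpredT f).
rewrite -(perm_big _ (permEl (perm_sort (fun a b => b <= a) _))) /= [RHS](big_nth 0).
rewrite size_sort size_map (size_enum_ord r); apply: eq_big_nat => i /andP [_ ir].
by rewrite /sigma (singular_valuesE hX s0) nth_cat size_sort size_map size_enum_ord ir.
Qed.

(** Indices start at 0, so [r.-1] is the place of the r-th value, the least one of the decreasing
    list before the padding. *)
Lemma sigma_last p q r (X : 'M[F]_(p, q)) (U : 'M[F]_(p, r)) s V i :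
  is_svd X U s V -> (forall i, 0 <= s i) -> sigma X r.-1 <= s i.
Proof.
move=> hX s0; rewrite /sigma (singular_valuesE hX s0) nth_cat.
rewrite size_sort size_map size_enum_ord.
have r0 : (0 < r)%N by case: (r) i => // -[].
rewrite prednK // leqnn; set l := sort _ _.
have : s i \in l by rewrite mem_sort map_f // mem_enum.
move/(nthP 0) => [j jl <-].
have ls : size l = r by rewrite size_sort size_map size_enum_ord.
have tr : transitive (fun a b : R => b <= a) by move=> a b c h1 h2; exact: le_trans h2 h1.
apply: (sorted_leq_nth tr _ 0); rewrite ?inE ?ls //.
- by apply: sort_sorted => a b; exact: le_total.
- by rewrite -ls.
- by rewrite prednK.
- by rewrite -ltnS prednK // -ls.
Qed.

End Sigma.

(** * The convex function Phi *)

Section Penalty.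
Variables (R : realType) (mu : R).
Hypothesis mu_gt0 : 0 < mu.
Local Notation e := (Num.sqrt mu).

Lemma sqrt_mu_sqr : e ^+ 2 = mu. Proof. by rewrite sqr_sqrtr // ltW. Qed.

Lemma sqrt_mu_gt0 : 0 < e. Proof. by rewrite sqrtr_gt0. Qed.

Lemma r_mu_small s : s <= e -> r_mu mu s = 2 * e * s - s ^+ 2.
Proof.
move=> se; rewrite /r_mu max_l ?subr_ge0 // -[X in X - _]sqrt_mu_sqr; ring.
Qed.

Lemma r_mu_large s : e <= s -> r_mu mu s = mu.
Proof. by move=> se; rewrite /r_mu max_r ?subr_le0 // expr0n subr0. Qed.

Lemma r_mu0 : r_mu mu 0 = 0.
Proof. by rewrite r_mu_small ?sqrtr_ge0 //; ring. Qed.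

Lemma r_mu_le s : r_mu mu s <= mu.
Proof. by rewrite /r_mu lerBlDr lerDl sqr_ge0. Qed.

(** For s <= sqrt(mu) the left side is 2 sqrt(mu) s, and the bound is the arithmetic-geometric
    inequality for sqrt(mu) b and c. Otherwise it is mu + s^2, and one adds s^2 <= b^2 c^2 to mu (1
    - b^2) <= c^2 (1 - b^2). *)
Lemma penalty_factor_le s b c : 0 <= s -> 0 <= b <= 1 -> s <= b * c ->
  r_mu mu s + s ^+ 2 <= mu * b ^+ 2 + c ^+ 2.
Proof.
move=> s0 /andP [b0 b1] sbc; have e0 := sqrt_mu_gt0.
have [se|/ltW es] := leP s e.
  rewrite r_mu_small // subrK -[X in _ <= X * _ + _]sqrt_mu_sqr.
  have : 0 <= (e * b - c) ^+ 2 by exact: sqr_ge0.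
  have : e * s <= e * (b * c) by rewrite ler_pM2l.
  by nra.
rewrite r_mu_large //.
have s1 : e ^+ 2 <= s ^+ 2 by rewrite ler_pXn2r ?nnegrE // ltW.
have s2 : s ^+ 2 <= (b * c) ^+ 2 by rewrite ler_pXn2r ?nnegrE // (le_trans s0).
have b2 : 0 <= 1 - b ^+ 2 by rewrite subr_ge0 exprn_ile1.
have s3 : s ^+ 2 <= c ^+ 2.
  by apply: le_trans s2 _; rewrite exprMn ler_piMl ?sqr_ge0 // exprn_ile1.
rewrite sqrt_mu_sqr in s1.
have : mu * (1 - b ^+ 2) <= c ^+ 2 * (1 - b ^+ 2) by rewrite ler_wpM2r // (le_trans s1).
by rewrite exprMn in s2; nra.
Qed.

(** The equality case of the previous bound: b = 1 and c = s above sqrt(mu), and sqrt(mu) b = c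
    below. The value of c^2 later identifies the singular values of a subgradient. *)
Lemma penalty_factor s : 0 < s ->
  exists b c : R, [/\ 0 <= b <= 1, b * c = s,
    mu * b ^+ 2 + c ^+ 2 = r_mu mu s + s ^+ 2 & c ^+ 2 = s * Num.max s e].
Proof.
move=> s0; have e0 := sqrt_mu_gt0.
have [se|/ltW es] := leP s e; last first.
  exists 1, s; rewrite ler01 lexx r_mu_large // !mul1r expr1n mulr1.
  by split=> //; rewrite expr2.
have se0 : 0 <= s / e by rewrite divr_ge0 // ltW.
have se1 : 0 <= s * e by rewrite mulr_ge0 // ltW.
exists (Num.sqrt (s / e)), (Num.sqrt (s * e)); split.
- rewrite sqrtr_ge0 /= -[leRHS]sqrtr1 ler_wsqrtr // ler_pdivrMr // mul1r //.
- rewrite -sqrtrM // (_ : s / e * (s * e) = s ^+ 2); last by field; rewrite gt_eqF.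
  by rewrite sqrtr_sqr gtr0_norm.
- rewrite !sqr_sqrtr // r_mu_small // -[X in X * _ + _]sqrt_mu_sqr.
  by field; rewrite gt_eqF.
- by rewrite sqr_sqrtr.
Qed.

End Penalty.

Section Phi.
Variables (R : realType) (k : scalar_kind) (mu : R).
Hypothesis mu_gt0 : 0 < mu.
Local Notation F := (entries R k).
Local Notation e := (Num.sqrt mu).

Definition Phi p q (X : 'M[F]_(p, q)) : R :=
  \sum_(i < minn p q) r_mu mu (sigma X i) + frob X ^+ 2.

Lemma frob_svd p q r (X : 'M[F]_(p, q)) (U : 'M[F]_(p, r)) s V :
  is_svd X U s V -> frob X ^+ 2 = \sum_i s i ^+ 2.
Proof. by move=> [hU hV ->]; rewrite frob_isom_adj // frob_isom // frob_dg. Qed.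

Lemma Phi_svd p q r (X : 'M[F]_(p, q)) (U : 'M[F]_(p, r)) s V :
  is_svd X U s V -> (forall i, 0 <= s i) ->
  Phi X = \sum_i (r_mu mu (s i) + s i ^+ 2).
Proof.
move=> hX s0; rewrite /Phi (sum_sigma hX s0 (r_mu0 mu_gt0)) (frob_svd hX).
by rewrite [RHS]big_split.
Qed.

Lemma svd_adj p q r (X : 'M[F]_(p, q)) (U : 'M[F]_(p, r)) s V :
  is_svd X U s V -> is_svd X^H V s U.
Proof.
by move=> [hU hV ->]; split=> //; rewrite !adjmxM adjmxK adjmx_dg mulmxA.
Qed.

Lemma Phi_adj p q (X : 'M[F]_(p, q)) : Phi X^H = Phi X.
Proof.
have [r [U [s [V [hX s0]]]]] := svd_exists X.
have s0' i := ltW (s0 i).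
by rewrite (Phi_svd hX s0') (Phi_svd (svd_adj hX) s0').
Qed.

Lemma frob_sum_col p q (X : 'M[F]_(p, q)) :
  frob X ^+ 2 = \sum_j frob (col j X) ^+ 2.
Proof.
rewrite frob_sqr ip_norm exchange_big /=; apply: eq_bigr => j _.
rewrite frob_sqr ip_norm; apply: eq_bigr => i _.
by rewrite big_ord1 mxE.
Qed.

Lemma isom_col p q (U : 'M[F]_(p, q)) i : isom U -> isom (col i U).
Proof.
move=> hU; rewrite /isom colE adjmxM -mulmxA (mulmxA U^H) hU mul1mx -colE.
apply/matrixP => a b; rewrite !ord1 mxE adjmxE !mxE !eqxx /= /delta_mx.
by rewrite rmorph1.
Qed.

Lemma frob_isom1 p (u : 'cV[F]_p) : isom u -> frob u = 1.
Proof.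
move=> hu; apply/eqP; rewrite -(@eqrXn2 _ 2) ?frob_ge0 //.
by rewrite frob_sqr_isom // expr1n.
Qed.

Lemma svd_core p q r (X : 'M[F]_(p, q)) (U : 'M[F]_(p, r)) s V :
  is_svd X U s V -> dg k s = U^H *m X *m V.
Proof.
by move=> [hU hV ->]; rewrite !mulmxA hU mul1mx -mulmxA hV mulmx1.
Qed.

Lemma frob_delta p (i : 'I_p) : frob (delta_mx i 0 : 'cV[F]_p) = 1.
Proof.
have h1 : isom (1%:M : 'M[F]_p) by rewrite /isom adjmx1 mulmx1.
by have := frob_isom1 (isom_col i h1); rewrite colE mul1mx.
Qed.

Lemma dg_delta p (x : 'I_p -> R) i :
  dg k x *m (delta_mx i 0 : 'cV[F]_p) = ofR k (x i) *: delta_mx i 0.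
Proof.
apply/matrixP => a b; rewrite mul_dgE !mxE; case: eqP => [->|_] //=.
by rewrite !mulr0.
Qed.

Lemma svd_entry p q r (X : 'M[F]_(p, q)) (U : 'M[F]_(p, r)) s V i :
  is_svd X U s V -> s i = ip (col i U) (X *m col i V).
Proof.
move=> hX; rewrite !colE ip_mull !mulmxA -(svd_core hX) dg_delta ipZr.
by rewrite -frob_sqr frob_delta expr1n mulr1.
Qed.

(** A singular value of BC is <B^H u, C v> <= |B^H u| |C v| for unit singular vectors u, v, and |B^H
    u| <= 1, so the scalar bound applies to each one. The squares |B^H u|^2 and |C v|^2 sum to at
    most |B|^2 and |C|^2. *)
Lemma Phi_mul_le p q r (B : 'M[F]_(p, r)) (C : 'M[F]_(r, q)) :
  (forall w : 'cV[F]_p, frob (B^H *m w) <= frob w) ->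
  Phi (B *m C) <= mu * frob B ^+ 2 + frob C ^+ 2.
Proof.
move=> hB; have [n [U [s [V [hX s0]]]]] := svd_exists (B *m C).
have [hU hV _] := hX.
rewrite (Phi_svd hX (fun i => ltW (s0 i))).
apply: (@le_trans _ _ (\sum_i (mu * frob (col i (B^H *m U)) ^+ 2 +
                               frob (col i (C *m V)) ^+ 2))).
  apply: ler_sum => i _; apply: penalty_factor_le => //; first exact: ltW.
    rewrite frob_ge0 /= colE -mulmxA -colE.
    by apply: le_trans (hB _) _; rewrite frob_isom1 //; exact: isom_col.
  rewrite (svd_entry i hX) -mulmxA -{1}[B]adjmxK -ip_mull !colE !mulmxA -!colE.
  exact: cauchy_schwarz.
rewrite big_split -mulr_sumr -!frob_sum_col lerD //.
  rewrite ler_wpM2l ?(ltW mu_gt0) // ler_pXn2r ?nnegrE ?frob_ge0 //.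
  by rewrite -(frob_adj B); exact: frob_coisom_r.
by rewrite ler_pXn2r ?nnegrE ?frob_ge0 //; exact: frob_coisom_r.
Qed.

Lemma ip_svd_col p q r (U : 'M[F]_(p, r)) (V : 'M[F]_(q, r)) s i :
  isom U -> isom V ->
  ip (U *m dg k s *m V^H) (col i U *m (col i V)^H) = s i.
Proof.
move=> hU hV; rewrite ipC ip_mulr adjmxK.
by rewrite (@svd_entry _ _ _ (U *m dg k s *m V^H) U s V i).
Qed.

End Phi.

(** * Simultaneous singular value decompositions *)

Section Pairs.
Variables (R : realType) (k : scalar_kind).
Local Notation F := (entries R k).

(** Zero values are allowed, so the shared families of singular vectors may be longer than the rank
    of either matrix. *)
Definition common_svd (P : R -> R -> Prop) p q (X Z : 'M[F]_(p, q)) : Prop :=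
  exists (r : nat) (U : 'M[F]_(p, r)) (V : 'M[F]_(q, r)) (x z : 'I_r -> R),
  [/\ isom U, isom V, X = U *m dg k x *m V^H, Z = U *m dg k z *m V^H &
      forall i, P (x i) (z i)].

Lemma svd_orth p q r n (W : 'M[F]_(p, q)) (U' : 'M[F]_(p, n)) w (V' : 'M[F]_(q, n))
    (U : 'M[F]_(p, r)) :
  is_svd W U' w V' -> (forall i, 0 < w i) -> U^H *m W = 0 -> U^H *m U' = 0.
Proof.
move=> [hU hV ->] w0; rewrite !mulmxA => /eqP; rewrite -(mul0mx _ (V'^H)) => /eqP.
move/(mulmx_isom_inj hV) /(congr1 (mulmx^~ (invmx (dg k w)))).
by rewrite mulmxK ?mul0mx // dg_unit // => i; rewrite gt_eqF.
Qed.

Lemma dg0 n : dg k (fun _ : 'I_n => 0 : R) = 0.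
Proof. by apply/matrixP => i j; rewrite dgE rmorph0 mul0rn mxE. Qed.

(** The part W of Z outside the given pairs lives on the orthogonal complements of the ranges of U
    and V. An SVD of W completes the families, with x = 0 on the added pairs. *)
Lemma common_svd_extend (P : R -> R -> Prop) p q r (X Z : 'M[F]_(p, q))
    (U : 'M[F]_(p, r)) (V : 'M[F]_(q, r)) x z :
  is_svd X U x V -> U^H *m Z = dg k z *m V^H -> Z *m V = U *m dg k z ->
  (forall i, P (x i) (z i)) ->
  (forall (u : 'cV[F]_p) (v : 'cV[F]_q) w, 0 < w -> isom u -> isom v ->
     U^H *m u = 0 -> V^H *m v = 0 -> ip Z (u *m v^H) = w -> P 0 w) ->
  common_svd P X Z.
Proof.
move=> [hU hV XE] UZ ZV Pxz P0.
pose W := Z - U *m dg k z *m V^H.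
have UW : U^H *m W = 0 by rewrite mulmxBr UZ !mulmxA hU mul1mx subrr.
have WV : W *m V = 0 by rewrite mulmxBl ZV -(mulmxA _ _ V) hV mulmx1 subrr.
have [n [U' [w [V' [hW w0]]]]] := svd_exists W.
have [hU' hV' WE] := hW.
have UU := svd_orth hW w0 UW.
have VV : V^H *m V' = 0.
  by apply: (svd_orth (svd_adj hW) w0); rewrite -adjmxM WV adjmx0.
exists (r + n)%N, (row_mx U U'), (row_mx V V'), (catf x (fun=> 0)), (catf z w).
split; try exact: isom_row.
- by rewrite row_dg_adj dg0 mulmx0 mul0mx addr0.
- by rewrite row_dg_adj -WE addrC subrK.
- move=> i; rewrite /catf; case: (fintype.split i) => j //.
  have Uc : U^H *m col j U' = 0 by rewrite colE mulmxA UU mul0mx.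
  apply: (P0 (col j U') (col j V')) => //; try exact: isom_col.
    by rewrite colE mulmxA VV mul0mx.
  rewrite -(subrK (U *m dg k z *m V^H) Z) ipDl -/W WE ip_svd_col //.
  by rewrite -mulmxA ip_mull mulmxA Uc mul0mx ip0r addr0.
Qed.

(** Bessel's inequality: row i holds the coefficients of the unit vector [col i U] against
    orthonormal vectors. *)
Lemma frob_le1_row p q r (U : 'M[F]_(p, q)) (V : 'M[F]_(p, r)) i :
  isom U -> isom V -> \sum_j modulus ((U^H *m V) i j) ^+ 2 <= 1.
Proof.
move=> hU hV; have := frob_coisom_r (col i U)^H hV.
rewrite frob_adj frob_isom1; last exact: isom_col.
rewrite -(@ler_pXn2r _ 2) ?nnegrE ?frob_ge0 // expr1n frob_sqr ip_norm big_ord1.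
rewrite (eq_bigr (fun j => modulus ((U^H *m V) i j) ^+ 2)) // => j _.
congr (modulus _ ^+ 2); rewrite !mxE; apply: eq_bigr => l _.
by rewrite !mxE.
Qed.

Lemma modulus_gramC p q r (U : 'M[F]_(p, q)) (V : 'M[F]_(p, r)) i j :
  modulus ((U^H *m V) i j) = modulus ((V^H *m U) j i).
Proof.
by rewrite -[U^H *m V]adjmxK adjmxE modulus_cj adjmxM adjmxK.
Qed.

Lemma ip_cross p q r r' (U : 'M[F]_(p, r)) x (V : 'M[F]_(q, r))
    (U' : 'M[F]_(p, r')) x' (V' : 'M[F]_(q, r')) :
  ip (U *m dg k x *m V^H) (U' *m dg k x' *m V'^H) =
  \sum_i \sum_j x i * x' j *
    reE ((U^H *m U') i j * cj ((V^H *m V') i j)).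
Proof.
rewrite ip_mulr adjmxK ip_mull -!mulmxA.
rewrite (_ : V'^H *m V = (V^H *m V')^H); last by rewrite adjmxM adjmxK.
rewrite ipE; set G := U^H *m U'; set H := V^H *m V'.
apply: eq_bigr => i _; rewrite (bigD1 i) //= big1 ?addr0 => [|j /negbTE ji].
  rewrite dgE eqxx mulr1n cj_ofR reE_ofRM !mulmxA mxE raddf_sum mulr_sumr.
  apply: eq_bigr => j _; rewrite mulmx_dgE adjmxE -/G -!mulrA /=.
  by congr (_ * _); rewrite mulrCA reE_ofRM.
by rewrite dgE eq_sym ji mulr0n rmorph0 mul0r raddf0.
Qed.

Lemma ip_diag p q r (U : 'M[F]_(p, r)) (V : 'M[F]_(q, r)) x y :
  isom U -> isom V ->
  ip (U *m dg k x *m V^H) (U *m dg k y *m V^H) = \sum_i x i * y i.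
Proof.
move=> hU hV; rewrite ip_mulr adjmxK -[_ *m V]mulmxA hV mulmx1 ip_mull mulmxA.
rewrite hU mul1mx /ip adjmx_dg dg_mul /dg mxtrace_diag raddf_sum.
by apply: eq_bigr => i _; rewrite mxE /= ofRK.
Qed.

(** Each product of a left and a right overlap is at most P i j, the mean of their squares, and P is
    doubly substochastic. Inserting P into all four terms bounds the inner product below by the sum
    of P i j (x'_j - x_i)(y'_j - y_i). *)
Lemma mono_pairs p q r r' (U : 'M[F]_(p, r)) (V : 'M[F]_(q, r)) x y
    (U' : 'M[F]_(p, r')) (V' : 'M[F]_(q, r')) x' y' :
  isom U -> isom V -> isom U' -> isom V' ->
  (forall i, 0 <= x i) -> (forall i, 0 <= y i) ->
  (forall i, 0 <= x' i) -> (forall i, 0 <= y' i) ->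
  (forall i j, 0 <= (x' j - x i) * (y' j - y i)) ->
  0 <= ip (U' *m dg k x' *m V'^H - U *m dg k x *m V^H)
          (U' *m dg k y' *m V'^H - U *m dg k y *m V^H).
Proof.
move=> hU hV hU' hV' x0 y0 x'0 y'0 hm.
rewrite ipBl !ipBr !ip_diag // (ipC _ (U *m dg k y *m V^H)) !ip_cross.
pose P i j := (modulus ((U^H *m U') i j) ^+ 2 + modulus ((V^H *m V') i j) ^+ 2) / 2.
have P0 i j : 0 <= P i j by rewrite divr_ge0 ?addr_ge0 ?sqr_ge0.
have Prow i : \sum_j P i j <= 1.
  rewrite -mulr_suml big_split /= ler_pdivrMr // mul1r.
  by rewrite (_ : 2 = 1 + 1) // lerD // frob_le1_row.
have Pcol j : \sum_i P i j <= 1.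
  rewrite -mulr_suml big_split /= ler_pdivrMr // mul1r.
  rewrite (_ : 2 = 1 + 1) // lerD //.
    by under eq_bigr do rewrite modulus_gramC; exact: frob_le1_row.
  by under eq_bigr do rewrite modulus_gramC; exact: frob_le1_row.
have PE i j : reE ((U^H *m U') i j * cj ((V^H *m V') i j)) <= P i j.
  apply: le_trans (ler_norm _) _; apply: le_trans (reE_le_modulus _) _.
  rewrite modulusM modulus_cj /P.
  set a := modulus _; set b := modulus _.
  by have := sqr_ge0 (a - b); nra.
set S1 := \sum_i \sum_j y i * x' j * _; set S2 := \sum_i \sum_j x i * y' j * _.
have h1 : S1 <= \sum_i \sum_j y i * x' j * P i j.
  by do 2 (apply: ler_sum => ? _); rewrite ler_wpM2l // mulr_ge0.
have h2 : S2 <= \sum_i \sum_j x i * y' j * P i j.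
  by do 2 (apply: ler_sum => ? _); rewrite ler_wpM2l // mulr_ge0.
(* Row and column sums of P may fall short of 1, so the diagonal terms must be nonnegative here. *)
have h3 : \sum_i \sum_j x i * y i * P i j <= \sum_i x i * y i.
  apply: ler_sum => i _; rewrite -mulr_sumr ler_piMr // mulr_ge0 //.
have h4 : \sum_i \sum_j x' j * y' j * P i j <= \sum_j x' j * y' j.
  rewrite exchange_big; apply: ler_sum => j _ /=.
  by rewrite -mulr_sumr ler_piMr // mulr_ge0.
have h5 : 0 <= \sum_i \sum_j (x' j - x i) * (y' j - y i) * P i j.
  by do 2 (apply: sumr_ge0 => ? _); rewrite mulr_ge0.
have h6 : \sum_i \sum_j (x' j - x i) * (y' j - y i) * P i j =
   \sum_i \sum_j x i * y i * P i j + \sum_i \sum_j x' j * y' j * P i j -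
   (\sum_i \sum_j y i * x' j * P i j + \sum_i \sum_j x i * y' j * P i j).
  rewrite -!big_split -sumrB /=; apply: eq_bigr => i _.
  rewrite -!big_split -sumrB /=; apply: eq_bigr => j _; ring.
lra.
Qed.

Lemma ip_isom1 p q (Z : 'M[F]_(p, q)) (u : 'cV[F]_p) (v : 'cV[F]_q) :
  isom u -> isom v -> ip Z (u *m v^H) <= frob Z.
Proof.
move=> hu hv; have := cauchy_schwarz Z (u *m v^H).
by rewrite frob_isom_adj // frob_isom1 // mulr1.
Qed.

Lemma pythagoras_isom p q r (M : 'M[F]_(p, q)) (V : 'M[F]_(q, r)) : isom V ->
  frob (M - M *m V *m V^H) ^+ 2 = frob M ^+ 2 - frob (M *m V) ^+ 2.
Proof.
move=> hV; rewrite frob_sqrB frob_isom_adj // (ipC M) ip_mulr adjmxK -frob_sqr.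
ring.
Qed.

Lemma frob_dg_ge n p (a : R) (s : 'I_n -> R) (M : 'M[F]_(n, p)) :
  0 <= a -> (forall i, a <= s i) -> a ^+ 2 * frob M ^+ 2 <= frob (dg k s *m M) ^+ 2.
Proof.
move=> a0 sa; rewrite !frob_sqr !ip_norm mulr_sumr; apply: ler_sum => i _.
rewrite mulr_sumr; apply: ler_sum => j _.
rewrite mul_dgE -!reE_cj_mul rmorphM /= cj_ofR.
rewrite (_ : ofR k (s i) * _ * _ = ofR k (s i ^+ 2) * (cj (M i j) * M i j)); last first.
  by rewrite rmorphXn; ring.
rewrite reE_ofRM reE_cj_mul ler_wpM2r ?sqr_ge0 //.
by rewrite ler_pXn2r ?nnegrE ?(le_trans a0).
Qed.

(** A form of the Eckart-Young bound. The projection 1 - V1 V1^H kills X, does not increase norms,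
    and leaves of X0 at least a times the norm of V^H (1 - V1 V1^H), whose square is r - |V^H V1|^2
    >= r - j. *)
Lemma low_rank_distance p q r (X0 X : 'M[F]_(p, q)) (U : 'M[F]_(p, r)) s V (a : R) j :
  is_svd X0 U s V -> 0 <= a -> (forall i, a <= s i) -> (\rank X <= j)%N ->
  (r%:R - j%:R) * a ^+ 2 <= frob (X - X0) ^+ 2.
Proof.
move=> [hU hV XE] a0 sa rX.
have [n [U1 [x [V1 [hX x0]]]]] := svd_exists X.
have nj : (n <= j)%N.
  by rewrite -(svd_rank hX) // => i; rewrite gt_eqF.
have [hU1 hV1 XE1] := hX.
have XP : X *m V1 *m V1^H = X by rewrite XE1 -(mulmxA _ _ V1) hV1 mulmx1.
have h1 : frob (X0 - X0 *m V1 *m V1^H) ^+ 2 <= frob (X - X0) ^+ 2.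
  have -> : X0 - X0 *m V1 *m V1^H = - ((X - X0) - (X - X0) *m V1 *m V1^H).
    rewrite !mulmxBl XP; move: (X0 *m V1 *m V1^H) => Y.
    by apply/matrixP => i l; rewrite !mxE; ring.
  by rewrite frobN pythagoras_isom // gerBl sqr_ge0.
apply: le_trans h1.
have -> : X0 - X0 *m V1 *m V1^H = U *m (dg k s *m (V^H - V^H *m V1 *m V1^H)).
  by rewrite XE !mulmxBr !mulmxA.
rewrite frob_isom //; apply: le_trans (frob_dg_ge _ a0 sa).
rewrite mulrC ler_wpM2l ?sqr_ge0 // pythagoras_isom // frob_adj frob_sqr_isom //.
rewrite lerD2l lerN2 (@le_trans _ _ n%:R) ?ler_nat //.
rewrite -(frob_sqr_isom hV1) ler_pXn2r ?nnegrE ?frob_ge0 //.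
exact: frob_coisom.
Qed.

End Pairs.

(** * Stationary points *)

Section Stationary.
Variables (R : realType) (k : scalar_kind) (mu : R).
Hypothesis mu_gt0 : 0 < mu.
Local Notation F := (entries R k).
Local Notation e := (Num.sqrt mu).

(** For x > 0, 2 z is the derivative at x of t -> r_mu(t) + t^2; for x = 0, it lies between 0 and
    the right derivative 2 sqrt(mu). *)
Definition subgrad_rel (x z : R) : Prop :=
  (0 < x /\ z = Num.max x e) \/ (x = 0 /\ 0 <= z <= e).

(** 2 <Z, D> bounds from below the slope of every quadratic majorant of [Phi] along the ray from X
    in direction D. First-order optimality is thus expressed without differentiating [Phi]. *)
Definition Phi_subgrad p q (X Z : 'M[F]_(p, q)) : Prop :=
  forall D L M t0, 0 < t0 ->
    (forall t, 0 < t < t0 ->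
       Phi mu (X + ofR k t *: D) <= Phi mu X + t * L + t ^+ 2 * M) ->
    2 * ip Z D <= L.

Lemma Phi_subgrad_adj p q (X Z : 'M[F]_(p, q)) :
  Phi_subgrad X Z -> Phi_subgrad X^H Z^H.
Proof.
move=> h D L M t0 t00 hL; rewrite -ip_adj adjmxK.
apply: (h _ _ M t0) => // t tt0; have := hL t tt0.
by rewrite Phi_adj // -Phi_adj // adjmxD adjmxK adjmxZ.
Qed.

Lemma isom_factor_contr p r (U : 'M[F]_(p, r)) b (w : 'cV[F]_p) :
  isom U -> (forall i, 0 <= b i <= 1) -> frob ((U *m dg k b)^H *m w) <= frob w.
Proof.
move=> hU hb; rewrite adjmxM adjmx_dg -mulmxA.
apply: le_trans (frob_coisom w hU).
rewrite -(@ler_pXn2r _ 2) ?nnegrE ?frob_ge0 // !frob_sqr !ip_norm.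
apply: ler_sum => i _; apply: ler_sum => j _.
have /andP [b0 b1] := hb i.
rewrite mul_dgE ler_pXn2r ?nnegrE ?modulus_ge0 // modulusM ler_piMl ?modulus_ge0 //.
apply: le_trans b1; rewrite -[leRHS]ger0_norm // -sqrtr_sqr /modulus toC_ofR /=.
by rewrite expr0n addr0.
Qed.

(** Factor X = BC with equality in [Phi_mul_le]. Along X + t X H = B (C + t C H) only C moves, so
    [Phi] has a quadratic majorant of slope 2 <C, C H>. As H is arbitrary, X^H Z = C^H C, and the
    factors V and diag(x) are cancelled. *)
Lemma Phi_subgrad_half p q r (X Z : 'M[F]_(p, q)) (U : 'M[F]_(p, r)) x V :
  is_svd X U x V -> (forall i, 0 < x i) -> Phi_subgrad X Z ->
  U^H *m Z = dg k (fun i => Num.max (x i) e) *m V^H.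
Proof.
move=> hX x0 hZ; have [hU hV XE] := hX.
have /choice [b hb] : forall i, exists b : R, exists c : R,
   [/\ 0 <= b <= 1, b * c = x i, mu * b ^+ 2 + c ^+ 2 = r_mu mu (x i) + x i ^+ 2
     & c ^+ 2 = x i * Num.max (x i) e].
  by move=> i; exact: penalty_factor.
have {hb} /choice [c hbc] := hb.
pose B := U *m dg k b; pose C := dg k c *m V^H.
have BC : B *m C = X.
  rewrite XE /B /C mulmxA -(mulmxA U) dg_mul; congr (_ *m dg k _ *m _).
  by apply/funext => i; have [_] := hbc i.
have PhiX : Phi mu X = mu * frob B ^+ 2 + frob C ^+ 2.
  rewrite (Phi_svd mu_gt0 hX) => [|i]; last exact: ltW.
  rewrite /B /C frob_isom // frob_isom_adj // !frob_dg mulr_sumr -big_split.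
  by apply: eq_bigr => i _ /=; have [_ _ ->] := hbc i.
have key H : ip Z (X *m H) <= ip C (C *m H).
  rewrite -(@ler_pM2l _ 2) //; apply: (hZ _ _ (frob (C *m H) ^+ 2) 1) => // t _.
  have -> : X + ofR k t *: (X *m H) = B *m (C + ofR k t *: (C *m H)).
    by rewrite mulmxDr -scalemxAr (mulmxA B C) BC.
  apply: le_trans (Phi_mul_le mu_gt0 _ _) _.
    by move=> w; apply: isom_factor_contr => // i; have [] := hbc i.
  rewrite PhiX frob_sqrD ipZr frobZ exprMn -normrX ger0_norm ?sqr_ge0 //.
  by rewrite le_eqVlt; apply/orP; left; apply/eqP; ring.
(* The inequality is tested with H = X^H Z - C^H C. *)
have : X^H *m Z = C^H *m C.
  apply/eqP; rewrite -subr_eq0; apply/eqP/ip_eq0; apply/eqP.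
  rewrite eq_le ip_ge0 andbT ipBl (ip_mull X^H) (ip_mull C^H) !adjmxK subr_le0.
  exact: key.
rewrite XE /C !adjmxM adjmxK !adjmx_dg -!mulmxA => /(isom_mulmx_inj hV).
move/(congr1 (mulmx (dg k (fun i => (x i)^-1)))).
rewrite !mulmxA !dg_mul.
have -> : (fun i => (x i)^-1 * x i) = fun=> 1.
  by apply/funext => i; rewrite mulVf // gt_eqF.
rewrite dg1 mul1mx => ->; congr (dg k _ *m _); apply/funext => i.
have [_ _ _] := hbc i; rewrite -mulrA -expr2 => ->.
by rewrite mulrA mulVf ?mul1r // gt_eqF.
Qed.

(** The previous lemma, for X and for its adjoint, settles the pairs with x > 0. If unit vectors u,
    v are orthogonal to U and V, then X + t u v^H has the additional singular value t, and [Phi]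
    grows by exactly 2 sqrt(mu) t for t < sqrt(mu); this bounds <Z, u v^H>. *)
Lemma Phi_subgrad_common_svd p q (X Z : 'M[F]_(p, q)) :
  Phi_subgrad X Z -> common_svd subgrad_rel X Z.
Proof.
move=> hZ; have e0 := sqrt_mu_gt0 mu_gt0.
have [r [U [x [V [hX x0]]]]] := svd_exists X.
have [hU hV XE] := hX.
apply: (@common_svd_extend _ _ _ _ _ _ _ _ U V x (fun i => Num.max (x i) e)) => //.
- exact: (Phi_subgrad_half hX x0 hZ).
- have := Phi_subgrad_half (svd_adj hX) x0 (Phi_subgrad_adj hZ).
  by move=> h; rewrite -[LHS]adjmxK adjmxM h adjmxM adjmxK adjmx_dg.
- by move=> i; left.
- move=> u v w w0 hu hv Uu Vv Zw; right; split=> //.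
  rewrite (ltW w0) -Zw -(@ler_pM2l _ 2) //=.
  apply: (hZ _ _ 0 e) => // t /andP [t0 te].
  have hD : is_svd (ofR k t *: (u *m v^H)) u (fun _ : 'I_1 => t) v.
    split=> //; rewrite [dg _ _](_ : _ = (ofR k t)%:M) ?mul_mx_scalar -?scalemxAl //.
    by apply/matrixP => i j; rewrite dgE mxE.
  have hXD := svd_cat hX hD Uu Vv.
  rewrite (Phi_svd mu_gt0 hXD); last first.
    by move=> i; rewrite /catf; case: fintype.split => j; rewrite ltW.
  rewrite (Phi_svd mu_gt0 hX) => [|i]; last exact: ltW.
  rewrite big_split_ord big_ord1 /= catf_r.
  under eq_bigr do rewrite catf_l.
  by rewrite r_mu_small // ?(ltW te) // subrK mulr0 addr0 lerD2l mulrC.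
Qed.

Lemma entries_norm (x : F) : `|x| = ofR k (modulus x).
Proof.
rewrite /modulus; move: x; rewrite /ofR /toC; case: k => x /=.
  by rewrite expr0n addr0 sqrtr_sqr.
by rewrite normc_def; case: x.
Qed.

(** Radii of balls in F are elements of F; over the complex numbers, positivity forces them to be
    real. *)
Lemma entries_gt0 (x : F) : 0 < x -> exists2 r : R, 0 < r & x = ofR k r.
Proof.
move=> x0; exists (modulus x); last by rewrite -entries_norm gtr0_norm.
by rewrite lt_neqAle modulus_ge0 eq_sym modulus_eq0 gt_eqF.
Qed.

Lemma ofR_lt (x y : R) : (ofR k x < ofR k y) = (x < y).
Proof. by rewrite /ofR; case: k => //; rewrite ltcR. Qed.

Lemma modulus_ofR (x : R) : modulus (ofR k x) = `|x|.
Proof. by rewrite /modulus toC_ofR /= expr0n addr0 sqrtr_sqr. Qed.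

Lemma modulus_le_frob p q (X : 'M[F]_(p, q)) i j : modulus (X i j) <= frob X.
Proof.
rewrite -(@ler_pXn2r _ 2) ?nnegrE ?frob_ge0 ?modulus_ge0 //.
rewrite frob_sqr ip_norm (bigD1 i) //= (bigD1 j) //= -addrA lerDl.
apply: addr_ge0; first by apply: sumr_ge0 => ? _; rewrite sqr_ge0.
by do 2 (apply: sumr_ge0 => ? _); rewrite sqr_ge0.
Qed.

(** The lower limit is a supremum of infima over punctured neighbourhoods, one of which exceeds -d /
    |D|. Balls are those of the max norm, which the Frobenius norm dominates. *)
Lemma stationary_dir p q (g : 'M[F]_(p, q) -> R) (X D : 'M[F]_(p, q)) (d t0 : R) :
  stationary g X -> D != 0 -> 0 < d -> 0 < t0 ->
  exists2 t, 0 < t < t0 & - d * t <= g (X + ofR k t *: D) - g X.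
Proof.
move=> gX D0 d0 t00.
have fD0 : 0 < frob D by rewrite lt_neqAle frob_ge0 eq_sym frob_eq0 D0.
move: gX; rewrite /stationary limf_einfE => h.
have [_ [V nV <-] hV] : exists2 y, [set ereal_inf ((fun Y : 'M[F]_(p, q) =>
    ((g Y - g X) / frob (Y - X))%:E) @` V) | V in X^'] y & ((- d / frob D)%:E < y)%E.
  apply/ereal_sup_gt/(lt_le_trans _ h).
  by rewrite lte_fin mulNr oppr_lt0 divr_gt0.
have /nbhs_ballP [r /= r0 hr] : nbhs X [set Y | Y != X -> V Y] by [].
have [r' r'0 rE] := entries_gt0 r0.
(* The first term keeps t below t0, the second keeps |t D| at most r' / 2. *)
pose t := Num.min (t0 / 2) (r' / (2 * frob D)).
have t_gt0 : 0 < t by rewrite lt_min !divr_gt0 // mulr_gt0.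
have tt0 : t < t0.
  rewrite (@le_lt_trans _ _ (t0 / 2)) ?ge_min ?lexx // ltr_pdivrMr //; lra.
have tr : t * frob D < r'.
  rewrite (@le_lt_trans _ _ (r' / 2)) ?ltr_pdivrMr //; last lra.
  rewrite (@le_trans _ _ (r' / (2 * frob D) * frob D)) //.
    by rewrite ler_wpM2r ?frob_ge0 // ge_min lexx orbT.
  by rewrite le_eqVlt; apply/orP; left; apply/eqP; field; rewrite gt_eqF.
exists t; first by rewrite t_gt0.
have tD : ofR k t *: D != 0.
  by rewrite -frob_eq0 frobZ mulf_neq0 ?normr_eq0 // gt_eqF.
have VY : V (X + ofR k t *: D).
  apply: hr; last by rewrite -subr_eq0 addrC addKr.
  split=> // i j; rewrite /ball /= !mxE opprD addNKr normrN entries_norm rE ofR_lt.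
  rewrite modulusM modulus_ofR gtr0_norm // (le_lt_trans _ tr) //.
  by rewrite ler_wpM2l ?modulus_le_frob // ltW.
have : ((- d / frob D)%:E < ((g (X + ofR k t *: D) - g X) /
    frob (X + ofR k t *: D - X))%:E)%E.
  by apply: (lt_le_trans hV); apply: ereal_inf_lbound; exists (X + ofR k t *: D).
rewrite lte_fin addrAC subrr add0r frobZ gtr0_norm // => /ltW.
rewrite ler_pdivlMr ?mulr_gt0 // (_ : - d / frob D * (t * frob D) = - d * t) //.
by field; rewrite gt_eqF.
Qed.

Lemma R_mu_reg_Phi p q m (A : 'M[F]_(p, q) -> 'cV[F]_m) b X :
  R_mu_reg mu A b X = Phi mu X - frob X ^+ 2 + frob (A X - b) ^+ 2.
Proof. by rewrite /R_mu_reg /Phi addrK. Qed.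

(** W is the adjoint of A applied to b - A X. The part |A X - b|^2 - |X|^2 of the functional has
    derivative -2 <X + W, D> along D, so a majorant of smaller slope would make the functional
    decrease at a linear rate L'. *)
Lemma stationary_Phi_subgrad p q m (A : {linear 'M[F]_(p, q) -> 'cV[F]_m}) b X W :
  (forall Y, ip W Y = ip (b - A X) (A Y)) ->
  stationary (R_mu_reg mu A b) X -> Phi_subgrad X (X + W).
Proof.
move=> hW hX D L M t0 t00 hL; rewrite leNgt; apply/negP => L0.
pose L' := L - 2 * ip (X + W) D; pose M' := M - frob D ^+ 2 + frob (A D) ^+ 2.
have L'0 : L' < 0 by rewrite subr_lt0.
have up t : 0 < t < t0 -> R_mu_reg mu A b (X + ofR k t *: D) - R_mu_reg mu A b X
    <= t * L' + t ^+ 2 * M'.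
  move=> ht; have := hL t ht; rewrite !R_mu_reg_Phi.
  have -> : A (X + ofR k t *: D) = A X + ofR k t *: A D by rewrite linearD linearZ.
  rewrite (_ : A X + _ - b = (A X - b) + ofR k t *: A D); last by rewrite addrAC.
  rewrite !frob_sqrD !ipZr !frobZ !exprMn -!normrX !(ger0_norm (sqr_ge0 t)).
  have hWD : ip W D = - ip (A X - b) (A D) by rewrite hW -opprB ipNl.
  rewrite /L' /M' (ipDl X) hWD => h.
  rewrite -subr_ge0; rewrite -subr_ge0 in h.
  by apply: (le_trans h); rewrite le_eqVlt; apply/orP; left; apply/eqP; ring.
have M1 : 0 < `|M'| + 1 by rewrite ltr_pwDr.
(* Below t1 the quadratic term uses up at most half of the linear decrease. *)
pose t1 := Num.min t0 (- L' / 2 / (`|M'| + 1)).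
have t10 : 0 < t1 by rewrite lt_min t00 !divr_gt0 // oppr_gt0.
have small t : 0 < t < t1 -> t * L' + t ^+ 2 * M' <= t * (L' / 2).
  move=> /andP [tp]; rewrite lt_min => /andP [_]; rewrite ltr_pdivlMr // => h.
  have : t * M' <= - L' / 2.
    apply: le_trans (ltW h); rewrite ler_pM2l //.
    by apply: le_trans (ler_norm _) _; rewrite lerDl.
  by move=> h2; rewrite expr2 -mulrA -mulrDr ler_pM2l //; lra.
(* For D = 0 there is no ray to follow, but the majorant itself then reads 0 <= t L' / 2 < 0. *)
have [D0|D0] := eqVneq D 0.
  have ht : 0 < t1 / 2 < t1 by rewrite divr_gt0 //=; rewrite ltr_pdivrMr //; lra.
  have ht0 : 0 < t1 / 2 < t0.
    have /andP [-> /= h] := ht; apply: lt_le_trans h _.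
    by rewrite ge_min lexx.
  have := up _ ht0; rewrite {1}D0 scaler0 addr0 subrr => h1.
  have := le_trans h1 (small _ ht).
  have /andP [tp _] := ht; rewrite pmulr_rge0 //; lra.
(* The slack -L' / 4 is less than the guaranteed decrease -L' / 2 per unit of t. *)
have [||t ht] := @stationary_dir _ _ _ X D (- L' / 4) t1 hX D0 => //; first lra.
have tt0 : 0 < t < t0.
  by have /andP [-> /= h] := ht; apply: lt_le_trans h _; rewrite ge_min lexx.
move=> h1; have := le_trans h1 (le_trans (up t tt0) (small t ht)).
have /andP [tp _] := ht; nra.
Qed.

End Stationary.

(** * Pushing singular values to endpoints *)

Section Linear.
Variables (R : realType) (k : scalar_kind).
Local Notation F := (entries R k).
Variables (p q m : nat) (A : {linear 'M[F]_(p, q) -> 'cV[F]_m}).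

Lemma linear_delta_sum X : A X = \sum_i \sum_j X i j *: A (delta_mx i j).
Proof.
rewrite {1}(matrix_sum_delta X) linear_sum; apply: eq_bigr => i _.
by rewrite linear_sum; apply: eq_bigr => j _; rewrite linearZ.
Qed.

(** W is the adjoint of A applied to y, and is used only through this identity. *)
Lemma riesz (y : 'cV[F]_m) : exists W, forall Y, ip W Y = ip y (A Y).
Proof.
exists (\matrix_(i, j) cj (\tr (y^H *m A (delta_mx i j)))) => Y.
rewrite ipE /ip linear_delta_sum mulmx_sumr linear_sum raddf_sum.
apply: eq_bigr => i _; rewrite mulmx_sumr /= linear_sum raddf_sum.
apply: eq_bigr => j _ /=.
by rewrite -scalemxAr linearZ /= mxE cjK mulrC.
Qed.

Lemma frob_scale a b (z : F) (X : 'M[F]_(a, b)) : frob (z *: X) = modulus z * frob X.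
Proof.
apply/eqP; rewrite -(@eqrXn2 _ 2) ?mulr_ge0 ?modulus_ge0 ?frob_ge0 //.
rewrite exprMn !frob_sqr !ip_norm mulr_sumr; apply/eqP/eq_bigr => i _.
by rewrite mulr_sumr; apply: eq_bigr => j _; rewrite mxE modulusM exprMn.
Qed.

Lemma frob_sum a b (I : finType) (f : I -> 'M[F]_(a, b)) :
  frob (\sum_i f i) <= \sum_i frob (f i).
Proof.
apply: (big_ind2 (fun M r => frob M <= r)) => //; first by rewrite frob0.
by move=> x1 x2 y1 y2 h1 h2; apply: le_trans (frobD _ _) _; exact: lerD.
Qed.

(** A crude bound that makes the set in [opnorm] bounded, so that its supremum is an upper bound. *)
Lemma linear_bounded X :
  frob (A X) <= frob X * \sum_i \sum_j frob (A (delta_mx i j)).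
Proof.
rewrite linear_delta_sum; apply: le_trans (frob_sum _) _.
rewrite mulr_sumr; apply: ler_sum => i _; apply: le_trans (frob_sum _) _.
rewrite mulr_sumr; apply: ler_sum => j _.
by rewrite frob_scale ler_wpM2r ?frob_ge0 // modulus_le_frob.
Qed.

Lemma frob_opnorm X : frob (A X) <= opnorm A * frob X.
Proof.
have [->|X0] := eqVneq X 0; first by rewrite linear0 !frob0 mulr0.
have x0 : 0 < frob X by rewrite lt_neqAle frob_ge0 eq_sym frob_eq0 X0.
rewrite -ler_pdivrMr //; apply: sup_upper_bound; last first.
  exists (ofR k (frob X)^-1 *: X).
    by rewrite /= frobZ gtr0_norm ?invr_gt0 // mulVf // gt_eqF.
  by rewrite linearZ /= frobZ gtr0_norm ?invr_gt0 // mulrC.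
split; first by exists (frob (A 0)), 0; rewrite //= frob0 ler01.
exists (\sum_i \sum_j frob (A (delta_mx i j))) => _ [Y /= Y1 <-].
apply: le_trans (linear_bounded Y) _; rewrite ler_piMl //.
by do 2 (apply: sumr_ge0 => ? _); exact: frob_ge0.
Qed.

End Linear.

(** * Strict concavity in each singular value below sqrt(mu) *)

Section Endpoint.
Variables (R : realType) (k : scalar_kind) (mu : R).
Hypothesis mu_gt0 : 0 < mu.
Local Notation F := (entries R k).
Local Notation e := (Num.sqrt mu).

Lemma rank_dg n (x : 'I_n -> R) : (\rank (dg k x) <= #|[pred i | x i != 0%R]|)%N.
Proof.
have -> : dg k x = \sum_(i | x i != 0) ofR k (x i) *: delta_mx i i.
  apply/matrixP => a b; rewrite dgE summxE.
  under eq_bigr do rewrite !mxE.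
  have [->|ab] := eqVneq a b; last first.
    rewrite mulr0n big1 // => i _; case: eqVneq => [<-|] /=; last by rewrite mulr0.
    by rewrite eq_sym (negbTE ab) mulr0.
  have [xb|xb] := eqVneq (x b) 0.
    rewrite xb rmorph0 big1 // => i xi; case: eqVneq => [ib|]; last by rewrite mulr0.
    by rewrite -ib xb eqxx in xi.
  rewrite (bigD1 b) //= eqxx mulr1 big1 ?addr0 // => i /andP [_ ib].
  by rewrite eq_sym (negbTE ib) mulr0.
rewrite -sum1_card; apply: (big_ind2 (fun (M : 'M[F]_n) s => (\rank M <= s)%N)).
- by rewrite mxrank0.
- by move=> M1 s1 M2 s2 h1 h2; apply: leq_trans (mxrank_add _ _) _; exact: leq_add.
- by move=> i _; apply: leq_trans (mxrank_scale _ _) _; rewrite mxrank_delta.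
Qed.

Lemma rank_svd_le p q r (U : 'M[F]_(p, r)) (V : 'M[F]_(q, r)) x :
  (\rank (U *m dg k x *m V^H) <= #|[pred i | x i != 0%R]|)%N.
Proof.
apply: leq_trans (mxrankM_maxl _ _) _; apply: leq_trans (mxrankM_maxr _ _) _.
exact: rank_dg.
Qed.

Definition set_at n (s : 'I_n -> R) i t j := if j == i then t else s j.

Lemma svd_set_at p q r (U : 'M[F]_(p, r)) (V : 'M[F]_(q, r)) s i t :
  U *m dg k (set_at s i t) *m V^H =
  U *m dg k (set_at s i 0) *m V^H + ofR k t *: (col i U *m (col i V)^H).
Proof.
have -> : dg k (set_at s i t) = dg k (set_at s i 0) + ofR k t *: delta_mx i i.
  apply/matrixP => a b; rewrite [in RHS]mxE !dgE !mxE /set_at.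
  have [->|ai] := eqVneq a i; last by rewrite mulr0 addr0.
  by rewrite rmorph0 mul0rn add0r eq_sym; case: eqP; rewrite (mulr0, mulr1).
rewrite mulmxDr mulmxDl; congr (_ + _).
rewrite -scalemxAr -scalemxAl; congr (_ *: _).
rewrite !colE adjmxM !mulmxA -(mulmxA U); congr (_ *m _ *m _).
have -> : (delta_mx i 0 : 'cV[F]_r)^H = delta_mx 0 i.
  apply/matrixP => a b; rewrite adjmxE !mxE andbC.
  by case: andP => _; rewrite (rmorph1, rmorph0).
by rewrite mul_delta_mx.
Qed.

Lemma concave_endpoint (c0 c1 c2 t : R) : c2 < 1 -> 0 < t < e ->
  c0 < 2 * e * t - t ^+ 2 + (c0 + 2 * (t * c1) + t ^+ 2 * c2) \/
  mu + (c0 + 2 * (e * c1) + e ^+ 2 * c2) <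
    2 * e * t - t ^+ 2 + (c0 + 2 * (t * c1) + t ^+ 2 * c2).
Proof.
move=> c21 /andP [t0 te]; have e2 := sqrt_mu_sqr mu_gt0.
have [h|h] := leP (2 * e + 2 * c1) ((1 - c2) * t).
  right; rewrite -{1}e2 -subr_gt0.
  rewrite (_ : _ - _ = (t - e) * (2 * e + 2 * c1 - (1 - c2) * (t + e))); last by ring.
  rewrite nmulr_rgt0 ?subr_lt0 //.
  have : 0 < (1 - c2) * e by rewrite mulr_gt0 ?subr_gt0 // (lt_trans t0).
  by rewrite mulrDr; lra.
left; rewrite -subr_gt0.
rewrite (_ : _ - _ = t * (2 * e + 2 * c1 - (1 - c2) * t)); last by ring.
by rewrite mulr_gt0 // subr_gt0.
Qed.

(** Induction on the number of values strictly between 0 and sqrt(mu). As a function of one such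
    value the functional is the quadratic above with c2 = |A(u v^H)|^2 < 1, so a move to an endpoint
    lowers it strictly. *)
Lemma push_endpoints p q m (A : {linear 'M[F]_(p, q) -> 'cV[F]_m}) b r
    (U : 'M[F]_(p, r)) (V : 'M[F]_(q, r)) (s : 'I_r -> R) :
  opnorm A < 1 -> isom U -> isom V -> (forall i, 0 <= s i) ->
  let pen s := \sum_i r_mu mu (s i) + frob (A (U *m dg k s *m V^H) - b) ^+ 2 in
  exists s' : 'I_r -> R, [/\ forall i, s' i = 0 \/ e <= s' i, pen s' <= pen s &
    (exists i, 0 < s i < e) -> pen s' < pen s].
Proof.
move=> A1 hU hV s0 pen; have e0 := sqrt_mu_gt0 mu_gt0.
have [n] := ubnP #|[pred i | 0 < s i < e]|; elim: n s s0 => // n IH s s0 sn.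
have [/existsP [i si]|/existsPn ns] := boolP [exists i, 0 < s i < e]; last first.
  exists s; split=> // [i|[i si]]; last by have := ns i; rewrite si.
  have := ns i; rewrite negb_and -leNgt -leNgt => /orP [h|]; last by right.
  by left; apply/eqP; rewrite eq_le h s0.
pose w := A (col i U *m (col i V)^H).
pose a := A (U *m dg k (set_at s i 0) *m V^H) - b.
have w1 : frob w ^+ 2 < 1.
  have : frob w <= opnorm A.
    apply: le_trans (frob_opnorm _ _) _.
    rewrite frob_isom_adj ?frob_isom1 ?mulr1 //; exact: isom_col.
  move=> h; have := le_lt_trans h A1.
  by rewrite expr_lt1 ?frob_ge0.
have penE t : pen (set_at s i t) = \sum_(j | j != i) r_mu mu (s j) + r_mu mu t +
    (frob a ^+ 2 + 2 * (t * ip a w) + t ^+ 2 * frob w ^+ 2).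
  rewrite /pen (bigD1 i) //= {1}/set_at eqxx [r_mu mu t + _]addrC.
  congr (_ + _ + _).
    by apply: eq_bigr => j /negbTE ji; rewrite /set_at ji.
  rewrite svd_set_at linearD linearZ /= addrAC -/a frob_sqrD ipZr frobZ exprMn.
  by rewrite -normrX ger0_norm ?sqr_ge0.
have sE : s = set_at s i (s i).
  by apply/funext => j; rewrite /set_at; case: eqP => [->|].
have [t [t0 te pt]] : exists t, [/\ 0 <= t, t = 0 \/ t = e &
    pen (set_at s i t) < pen s].
  have /andP [_ sie] := si.
  have := concave_endpoint (frob a ^+ 2) (ip a w) w1 si.
  rewrite [in pen s]sE !penE (r_mu_small mu_gt0 (ltW sie)) => -[h|h].
    exists 0; split=> //; first by left.
    by rewrite penE r_mu0 // expr0n !mul0r mulr0 !addr0 -[ltRHS]addrA ltrD2l.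
  exists e; split=> //; first by right.
  rewrite penE r_mu_large // -[ltLHS]addrA -[ltRHS]addrA ltrD2l.
  exact: h.
have [||s' [h1 h2 _]] := IH (set_at s i t).
- by move=> j; rewrite /set_at; case: ifP.
- rewrite -ltnS; apply: leq_trans sn; rewrite ltnS; apply: proper_card.
  apply/properP; split.
    apply/fintype.subsetP => j; rewrite !inE /set_at; case: eqP => // ->.
    by case: te => ->; rewrite ltxx ?andbF.
  exists i; rewrite ?inE // /set_at eqxx.
  by case: te => ->; rewrite ltxx ?andbF.
exists s'; split=> [||_]; first exact: h1.
  exact: (le_trans h2 (ltW pt)).
exact: (le_lt_trans h2 pt).
Qed.

End Endpoint.

(** * Existence of best low-rank approximations *)

Section ScalarContinuity.
Variables (R : realType) (k : scalar_kind) (T : topologicalType).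
Local Notation F := (entries R k).

Definition imE (x : F) : R := complex.Im (toC x).

(** Continuity through real and imaginary parts treats both fields at once and keeps all limits in
    R. *)
Definition ccont (f : T -> F) : Prop :=
  continuous (fun x => reE (f x)) /\ continuous (fun x => imE (f x)).

Lemma modulus_sqrE (x : F) : modulus x ^+ 2 = reE x ^+ 2 + imE x ^+ 2.
Proof.
rewrite /modulus /reE /imE; case: (toC x) => a b /=.
by rewrite sqr_sqrtr // addr_ge0 ?sqr_ge0.
Qed.

Lemma ccont_cst (c : F) : ccont (fun=> c).
Proof. by split=> x; exact: cvg_cst. Qed.

Lemma ccontD (f g : T -> F) : ccont f -> ccont g -> ccont (fun x => f x + g x).
Proof.
move=> [f1 f2] [g1 g2]; split.
  rewrite (_ : (fun _ => _) = fun x => reE (f x) + reE (g x)).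
    by move=> x; apply: cvgD; [exact: f1|exact: g1].
  by apply/funext => x; rewrite raddfD.
rewrite (_ : (fun _ => _) = fun x => imE (f x) + imE (g x)).
  by move=> x; apply: cvgD; [exact: f2|exact: g2].
by apply/funext => x; rewrite /imE raddfD /=; case: (toC (f x)); case: (toC (g x)).
Qed.

Lemma ccontM (f g : T -> F) : ccont f -> ccont g -> ccont (fun x => f x * g x).
Proof.
move=> [f1 f2] [g1 g2]; split.
  rewrite (_ : (fun _ => _) =
      fun x => reE (f x) * reE (g x) - imE (f x) * imE (g x)).
    move=> x; apply: cvgB; apply: cvgM;
      [exact: f1|exact: g1|exact: f2|exact: g2].
  apply/funext => x; rewrite /imE /reE rmorphM /=.
  by case: (toC (f x)) => ? ?; case: (toC (g x)).
rewrite (_ : (fun _ => _) = fun x => reE (f x) * imE (g x) + imE (f x) * reE (g x)).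
  move=> x; apply: cvgD; apply: cvgM;
    [exact: f1|exact: g2|exact: f2|exact: g1].
apply/funext => x; rewrite /imE /reE rmorphM /=.
by case: (toC (f x)) => ? ?; case: (toC (g x)).
Qed.

Lemma ccont_sum (I : Type) (r : seq I) (f : I -> T -> F) :
  (forall i, ccont (f i)) -> ccont (fun x => \sum_(i <- r) f i x).
Proof.
move=> hf; elim: r => [|i r IH].
  rewrite (_ : (fun _ => _) = fun=> 0); first exact: ccont_cst.
  by apply/funext => x; rewrite big_nil.
rewrite (_ : (fun _ => _) = fun x => f i x + \sum_(j <- r) f j x).
  exact: ccontD.
by apply/funext => x; rewrite big_cons.
Qed.

Lemma ccont_modulus (f : T -> F) : ccont f -> continuous (fun x => modulus (f x) ^+ 2).
Proof.
move=> [f1 f2]; rewrite (_ : (fun _ => _) =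
    fun x => reE (f x) * reE (f x) + imE (f x) * imE (f x)).
  by move=> x; apply: cvgD; apply: cvgM; (exact: f1 || exact: f2).
by apply/funext => x; rewrite modulus_sqrE !expr2.
Qed.

Lemma continuous_sumR (I : Type) (r : seq I) (f : I -> T -> R) :
  (forall i, continuous (f i)) -> continuous (fun x => \sum_(i <- r) f i x).
Proof.
move=> hf; elim: r => [|i r IH].
  rewrite (_ : (fun _ => _) = fun=> 0); first by move=> x; exact: cvg_cst.
  by apply/funext => x; rewrite big_nil.
rewrite (_ : (fun _ => _) = fun x => f i x + \sum_(j <- r) f j x).
  by move=> x; apply: cvgD; [exact: hf|exact: IH].
by apply/funext => x; rewrite big_cons.
Qed.

End ScalarContinuity.

Section BestLowRank.
Variables (R : realType) (k : scalar_kind).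
Local Notation F := (entries R k).

Definition mkF : R -> R -> F :=
  match k return R -> R -> entries R k with
  | RealScalars => fun a _ => a
  | ComplexScalars => fun a b => (a +i* b)%C
  end.

Lemma mkFK (z : F) : mkF (reE z) (imE z) = z.
Proof. by move: z; rewrite /mkF /reE /imE /toC; case: k => // -[]. Qed.

Lemma ccont_mkF (T : topologicalType) (f g : T -> R) :
  continuous f -> continuous g -> ccont (fun x => mkF (f x) (g x)).
Proof.
rewrite /ccont /mkF /reE /imE /toC => hf hg; case: k; split=> //= x.
exact: cvg_cst.
Qed.

Lemma imE_le_modulus (x : F) : `|imE x| <= modulus x.
Proof.
rewrite -(@ler_pXn2r _ 2) ?nnegrE ?modulus_ge0 // modulus_sqrE.
by rewrite -normrX ger0_norm ?sqr_ge0 // lerDr sqr_ge0.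
Qed.

(** B consists of left singular vectors padded with zero columns, and C carries the rest of the SVD.
    Matrices of rank at most K and bounded norm are thus products of factors from a bounded set. *)
Lemma rank_factor p q K (X : 'M[F]_(p, q)) : (\rank X <= K)%N ->
  exists (B : 'M[F]_(p, K)) (C : 'M[F]_(K, q)),
    [/\ X = B *m C, forall i j, modulus (B i j) <= 1 & frob C <= frob X].
Proof.
move=> rX; have [r [U [s [V [hX s0]]]]] := svd_exists X.
have [hU hV XE] := hX.
have rK : (r <= K)%N by rewrite -(svd_rank hX) // => i; rewrite gt_eqF.
pose J : 'M[F]_(r, K) := pid_mx r.
have JJ : J *m J^H = 1%:M.
  by rewrite map_pid_mx tr_pid_mx mul_pid_mx minnn (minn_idPr rK) pid_mx_1.
exists (U *m J), (J^H *m (dg k s *m V^H)); split.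
- by rewrite mulmxA -(mulmxA U) JJ mulmx1 mulmxA.
- move=> i j; rewrite mxE; have [jr|rj] := ltnP j r.
    rewrite (bigD1 (Ordinal jr)) //= big1 ?addr0 => [|l ll].
      rewrite !mxE /= eqxx jr mulr1.
      apply: (@le_trans _ _ (frob (col (Ordinal jr) U))).
        by have := modulus_le_frob (col (Ordinal jr) U) i 0; rewrite mxE.
      by rewrite frob_isom1 //; exact: isom_col.
    rewrite !mxE; case: eqP => [lj|]; last by rewrite mulr0.
    by rewrite -val_eqE /= lj eqxx in ll.
  rewrite big1 ?/modulus ?rmorph0 ?ComplexField.Normc.normc0 // => l _.
  rewrite !mxE; case: eqP => [lj|]; last by rewrite mulr0.
  by have := ltn_ord l; rewrite lj ltnNge rj.
- rewrite frob_isom; last by rewrite /isom adjmxK.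
  by rewrite XE -mulmxA (frob_isom _ hU) lexx.
Qed.

(** The residual is minimized over factors (B, C) with coordinates in a compact box, by continuity.
    Matrices whose norm exceeds r0 have a larger residual than 0, by the lower bound on A. *)
Lemma best_low_rank p q m (A : {linear 'M[F]_(p, q) -> 'cV[F]_m}) b K (c : R) :
  0 < c ->
  (forall X : 'M[F]_(p, q), (\rank X <= K)%N -> c * frob X ^+ 2 <= frob (A X) ^+ 2) ->
  exists2 X : 'M[F]_(p, q), (\rank X <= K)%N &
    forall Y : 'M[F]_(p, q), (\rank Y <= K)%N -> frob (A X - b) <= frob (A Y - b).
Proof.
(* The boolean selects the real or the imaginary part of an entry; over the reals [mkF] ignores the
   latter. *)
move=> c0 hA; pose T : finType := ('I_p * 'I_K * bool + 'I_K * 'I_q * bool)%type.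
pose N := #|T|.
pose x_ (x : 'rV[R]_N) (t : T) := x ord0 (enum_rank t).
pose B x : 'M[F]_(p, K) :=
  \matrix_(i, j) mkF (x_ x (inl (i, j, true))) (x_ x (inl (i, j, false))).
pose C x : 'M[F]_(K, q) :=
  \matrix_(i, j) mkF (x_ x (inr (i, j, true))) (x_ x (inr (i, j, false))).
pose f x := frob (A (B x *m C x) - b) ^+ 2.
have xc t : continuous (x_ ^~ t) by move=> x; exact: coord_continuous.
have fc : continuous f.
  rewrite (_ : f = fun x => \sum_l \sum_j modulus ((A (B x *m C x) - b) l j) ^+ 2).
    apply: continuous_sumR => l; apply: continuous_sumR => j; apply: ccont_modulus.
    rewrite (_ : (fun _ => _) = fun x =>
       \sum_i \sum_j' (\sum_h B x i h * C x h j') * A (delta_mx i j') l j + - b l j).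
      apply: ccontD; last exact: ccont_cst.
      apply: ccont_sum => i; apply: ccont_sum => j'; apply: ccontM; last exact: ccont_cst.
      apply: ccont_sum => h; apply: ccontM.
        rewrite (_ : (fun _ => _) = fun x =>
          mkF (x_ x (inl (i, h, true))) (x_ x (inl (i, h, false)))).
          exact: ccont_mkF.
        by apply/funext => x; rewrite mxE.
      rewrite (_ : (fun _ => _) = fun x =>
        mkF (x_ x (inr (h, j', true))) (x_ x (inr (h, j', false)))).
        exact: ccont_mkF.
      by apply/funext => x; rewrite mxE.
    apply/funext => x; rewrite linear_delta_sum !mxE summxE; congr (_ + _).
    apply: eq_bigr => i _; rewrite summxE; apply: eq_bigr => j' _.
    by rewrite !mxE.
  by apply/funext => x; rewrite /f frob_sqr ip_norm.
(* If |Y| >= r0 then |A Y| >= 2 |b|, so the residual of Y is at least |b|, that of 0. The summand 1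
   leaves room in the box for the entries of B. *)
pose r0 := 1 + 2 * frob b / Num.sqrt c.
have sc0 : 0 < Num.sqrt c by rewrite sqrtr_gt0.
have r1 : 1 <= r0 by rewrite lerDl divr_ge0 ?mulr_ge0 ?frob_ge0 // ltW.
pose S := [set v : 'rV[R]_N | forall i, `[- r0, r0]%classic (v ord0 i)].
have cS : compact S.
  apply: (@rV_compact R N (fun=> `[- r0, r0]%classic)) => i.
  exact: segment_compact.
have S0 : S !=set0.
  exists 0 => i /=; rewrite mxE in_itv /= oppr_le0.
  by rewrite (le_trans ler01 r1).
have [v _ hv] := compact_EVT_min S0 cS (continuous_subspaceT fc).
exists (B v *m C v); first by apply: leq_trans (mxrankM_maxl _ _) (rank_leq_col _).
have main Y : (\rank Y <= K)%N -> frob Y <= r0 ->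
    frob (A (B v *m C v) - b) <= frob (A Y - b).
  move=> rY Yr; have [B' [C' [YE B1 C1]]] := rank_factor rY.
  pose g (t : T) : R := match t with
    | inl (i, j, true) => reE (B' i j) | inl (i, j, false) => imE (B' i j)
    | inr (i, j, true) => reE (C' i j) | inr (i, j, false) => imE (C' i j) end.
  pose w : 'rV[R]_N := \row_i g (enum_val i).
  have wE t : x_ w t = g t by rewrite /x_ mxE enum_rankK.
  have BE : B w = B' by apply/matrixP => i j; rewrite mxE !wE mkFK.
  have CE : C w = C' by apply/matrixP => i j; rewrite mxE !wE mkFK.
  have C2 i j : modulus (C' i j) <= r0.
    by apply: le_trans (modulus_le_frob _ _ _) (le_trans C1 Yr).
  have wS : w \in S.
    rewrite inE => i /=; rewrite mxE in_itv /= -ler_norml.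
    case: (enum_val i) => -[[a a'] []] /=.
    - by apply: le_trans (reE_le_modulus _) (le_trans (B1 _ _) r1).
    - by apply: le_trans (imE_le_modulus _) (le_trans (B1 _ _) r1).
    - by apply: le_trans (reE_le_modulus _) (C2 _ _).
    - by apply: le_trans (imE_le_modulus _) (C2 _ _).
  have := hv w wS; rewrite /f BE CE -YE.
  by rewrite ler_pXn2r ?nnegrE ?frob_ge0.
move=> Y rY; have [Yr|/ltW Yr] := leP (frob Y) r0; first exact: main.
apply: (@le_trans _ _ (frob b)).
  have := main 0; rewrite linear0 sub0r frobN frob0 mxrank0.
  by apply=> //; apply: le_trans r1.
have h1 : Num.sqrt c * frob Y <= frob (A Y).
  rewrite -(@ler_pXn2r _ 2) ?nnegrE ?mulr_ge0 ?frob_ge0 ?sqrtr_ge0 //.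
  by rewrite exprMn sqr_sqrtr ?(ltW c0) // hA.
have h2 := frobB (A Y) b.
have : Num.sqrt c * r0 <= Num.sqrt c * frob Y by rewrite ler_pM2l.
have -> : Num.sqrt c * r0 = Num.sqrt c + 2 * frob b.
  by rewrite /r0; field; rewrite gt_eqF.
lra.
Qed.

End BestLowRank.

(** * Recovery *)

Lemma lower_ric_bound (R : realType) (k : scalar_kind) (p q m : nat)
    (A : {linear 'M[entries R k]_(p, q) -> 'cV[entries R k]_m}) J X :
  (\rank X <= J)%N -> (1 - lower_ric A J) * frob X ^+ 2 <= frob (A X) ^+ 2.
Proof.
move=> rX; have [->|X0] := eqVneq X 0.
  by rewrite frob0 expr0n mulr0 sqr_ge0.
have x0 : 0 < frob X ^+ 2.
  by rewrite exprn_gt0 // lt_neqAle frob_ge0 eq_sym frob_eq0 X0.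
rewrite -ler_pdivlMr // /lower_ric opprB addrCA subrr addr0.
apply: ge_inf; last by exists X.
by exists 0 => _ [Y _ <-]; rewrite divr_ge0 ?sqr_ge0.
Qed.

Lemma quadratic_ge0_slope (R : realFieldType) (a n : R) :
  (forall t, 0 <= 2 * (t * a) + t ^+ 2 * n) -> 0 <= n -> a = 0.
Proof.
move=> h n0; have n1 : 0 < n + 1 by rewrite ltr_wpDl.
(* The minimizer -a / n is replaced by -a / (n + 1), since n may be 0. *)
have := h (- a / (n + 1)).
rewrite (_ : _ + _ = - (a ^+ 2 * ((n + 2) / (n + 1) ^+ 2))); last first.
  by field; rewrite gt_eqF.
rewrite oppr_ge0 pmulr_lle0; last by rewrite divr_gt0 ?exprn_gt0 // ltr_wpDl.
by move=> a2; apply/eqP; rewrite -sqrf_eq0 eq_le a2 sqr_ge0.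
Qed.

Section Recovery.
Variables (R : realType) (k : scalar_kind) (n1 n2 m : nat) (mu c : R).
Local Notation F := (entries R k).
Local Notation e := (Num.sqrt mu).
Variables (A : {linear 'M[F]_(n1, n2) -> 'cV[F]_m}) (K : nat).
Variables (X0 : 'M[F]_(n1, n2)) (eps b : 'cV[F]_m).
Hypotheses (mu_gt0 : 0 < mu) (A_lt1 : opnorm A < 1) (K_ge1 : (1 <= K)%N).
Hypothesis c_gt0 : 0 < c.
Hypothesis ricP : forall X, (\rank X <= 2 * K)%N -> c * frob X ^+ 2 <= frob (A X) ^+ 2.
Hypotheses (bE : b = A X0 + eps) (rank_X0 : \rank X0 = K).
Hypothesis eps_le : frob eps <= c * Num.sqrt c * e / 3.
Hypothesis sigma_gt : (1 / c + c) * e < sigma X0 K.-1.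

(* Any value would do such that c' < c, frob eps <= c' * e, and e <= c' * x for
   every nonzero singular value x of a best rank K approximation. *)
Definition c' : R := 1 / (1 / c + c / 3).

(** X0 is nonzero of rank K, so c |X0|^2 <= |A X0|^2 < |X0|^2. *)
Lemma c_lt1 : c < 1.
Proof.
have x0 : 0 < frob X0.
  rewrite lt_neqAle frob_ge0 eq_sym frob_eq0 andbT; apply: contraTneq K_ge1 => X00.
  by rewrite -rank_X0 X00 mxrank0.
have h1 : c * frob X0 ^+ 2 <= frob (A X0) ^+ 2.
  by apply: ricP; rewrite rank_X0 mul2n -addnn leq_addr.
have h2 : frob (A X0) < frob X0.
  apply: le_lt_trans (frob_opnorm _ _) _.
  by rewrite gtr_pMl.
have h3 : frob (A X0) ^+ 2 < frob X0 ^+ 2 by rewrite ltr_pXn2r ?nnegrE ?frob_ge0.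
have := le_lt_trans h1 h3; rewrite gtr_pMl // exprn_gt0 //.
Qed.

Lemma e_gt0 : 0 < e. Proof. exact: sqrt_mu_gt0. Qed.

Lemma inv_c'_gt0 : 0 < 1 / c + c / 3.
Proof. by rewrite addr_gt0 // divr_gt0. Qed.

Lemma c'_gt0 : 0 < c'.
Proof. by rewrite /c' divr_gt0 // inv_c'_gt0. Qed.

Lemma c'_lt : c' < c.
Proof.
rewrite /c' ltr_pdivrMr ?inv_c'_gt0 // mulrDr mulrA mulr1 divff ?gt_eqF //.
by rewrite ltrDl mulr_gt0 // divr_gt0.
Qed.

Lemma sqrt_c : 0 < Num.sqrt c <= 1.
Proof.
by rewrite sqrtr_gt0 c_gt0 -[leRHS]sqrtr1 ler_wsqrtr // ltW // c_lt1.
Qed.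

Lemma eps_le_c' : frob eps <= c' * e.
Proof.
apply: le_trans eps_le _; rewrite mulrAC ler_pM2r ?e_gt0 //.
rewrite /c' ler_pdivlMr ?inv_c'_gt0 //.
have /andP [q0 q1] := sqrt_c; have c1 := c_lt1.
rewrite (_ : _ * _ = Num.sqrt c * (1 / 3 + c ^+ 2 / 9)); last first.
  by field; rewrite gt_eqF.
have c2 : c ^+ 2 <= 1 by rewrite exprn_ile1 // ltW.
rewrite mulr_ile1 ?(ltW q0) //; last lra.
by rewrite addr_ge0 ?divr_ge0 ?sqr_ge0.
Qed.

Lemma eps_lt : frob eps ^+ 2 < mu.
Proof.
rewrite -(sqrt_mu_sqr mu_gt0) ltr_pXn2r ?nnegrE ?frob_ge0 ?(ltW e_gt0) //.
apply: le_lt_trans eps_le_c' _; rewrite gtr_pMl ?e_gt0 //.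
exact: lt_trans c'_lt c_lt1.
Qed.

Definition is_best (X : 'M[F]_(n1, n2)) : Prop := (\rank X <= K)%N /\
  forall Y : 'M[F]_(n1, n2), (\rank Y <= K)%N -> frob (A X - b) <= frob (A Y - b).

Lemma best_residual X : is_best X -> frob (A X - b) <= frob eps.
Proof.
move=> [_ h]; have := h X0; rewrite rank_X0 leqnn bE opprD addNKr frobN.
exact.
Qed.

(** X - X0 has rank at most 2K, and |A(X - X0)| is at most the residual of X plus |eps|; that
    residual is at most the residual |eps| of X0. *)
Lemma best_error X : is_best X -> frob (X - X0) <= 2 * frob eps / Num.sqrt c.
Proof.
move=> hX; have /andP [q0 _] := sqrt_c.
have h1 : frob (A (X - X0)) <= 2 * frob eps.
  rewrite linearB /= (_ : A X - A X0 = (A X - b) + eps); last first.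
    by rewrite bE opprD addrA subrK.
  apply: le_trans (frobD _ _) _; have := best_residual hX; lra.
rewrite ler_pdivlMr // mulrC; apply: le_trans h1.
rewrite -(@ler_pXn2r _ 2) ?nnegrE ?mulr_ge0 ?frob_ge0 ?sqrtr_ge0 //.
rewrite exprMn sqr_sqrtr ?(ltW c_gt0) //; apply: ricP.
apply: leq_trans (mxrank_add _ _) _; rewrite eqmx_opp rank_X0 mul2n -addnn.
by rewrite leq_add2r; case: hX.
Qed.

Lemma svd_X0 : exists (U : 'M[F]_(n1, K)) (s : 'I_K -> R) (V : 'M[F]_(n2, K)),
  is_svd X0 U s V /\ forall i, (1 / c + c) * e <= s i.
Proof.
have [r [U [s [V [hX s0]]]]] := svd_exists X0.
have rK : r = K by rewrite -rank_X0 (svd_rank hX) // => i; rewrite gt_eqF.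
move: U s V hX s0; rewrite rK => U s V hX s0; exists U, s, V; split=> // i.
by apply: le_trans (ltW sigma_gt) (sigma_last i hX _) => j; exact: ltW.
Qed.

Lemma sigma0_ge0 : 0 <= (1 / c + c) * e.
Proof. by rewrite mulr_ge0 ?(ltW e_gt0) // addr_ge0 ?divr_ge0 ?ltW. Qed.

(** Deleting the value x_i gives Y of rank below K at distance x_i from X. By the Eckart-Young bound
    |Y - X0| >= (1/c + c) sqrt(mu), while |X - X0| <= (2c/3) sqrt(mu); the difference is left for
    x_i. *)
Lemma best_svd r X (U : 'M[F]_(n1, r)) x (V : 'M[F]_(n2, r)) i :
  is_best X -> is_svd X U x V -> (forall i, 0 < x i) -> (1 / c + c / 3) * e <= x i.
Proof.
move=> hX hsvd x0; have [hU hV XE] := hsvd.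
have rK : (r <= K)%N by rewrite -(svd_rank hsvd) => [|j]; [case: hX|rewrite gt_eqF].
pose Y := U *m dg k (set_at x i 0) *m V^H.
have rY : (\rank Y <= K.-1)%N.
  apply: leq_trans (rank_svd_le _ _ _) _; rewrite -ltnS prednK //.
  apply: leq_trans rK; rewrite -[X in (_ < X)%N](card_ord r); apply: proper_card.
  apply/properP; split; first by apply/fintype.subsetP.
  by exists i; rewrite ?inE // /set_at eqxx eqxx.
have [U0 [s [V0 [h0 s0]]]] := svd_X0.
have := low_rank_distance h0 sigma0_ge0 s0 rY.
rewrite -natrB ?leq_pred // -[K.-1]subn1 subKn // [leLHS]mul1r.
rewrite ler_pXn2r ?nnegrE ?frob_ge0 ?sigma0_ge0 // => hd.
have XY : X = Y + ofR k (x i) *: (col i U *m (col i V)^H).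
  rewrite -svd_set_at XE; congr (_ *m dg k _ *m _); apply/funext => j.
  by rewrite /set_at; case: eqP => [->|].
have h1 : frob (Y - X) = x i.
  rewrite XY opprD addNKr frobN frobZ gtr0_norm // frob_isom_adj.
    by rewrite frob_isom1 ?mulr1 //; exact: isom_col.
  exact: isom_col.
have h2 : frob (Y - X0) <= x i + frob (X - X0).
  by rewrite -h1; have := frobD (Y - X) (X - X0); rewrite addrA subrK.
have h3 : frob (X - X0) <= 2 * c * e / 3.
  apply: le_trans (best_error hX) _; have /andP [q0 _] := sqrt_c.
  rewrite ler_pdivrMr //; have := eps_le; lra.
by have := le_trans hd h2; lra.
Qed.

(** * First-order conditions at a best rank K approximation *)

Definition best_rel (x z : R) : Prop :=
  (z = x /\ e <= c' * x) \/ (x = 0 /\ 0 <= z <= c' * e).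

(** On a line inside the set of rank at most K, the squared residual is a quadratic in t minimal at
    t = 0, so its slope there vanishes. *)
Lemma best_orth X W H : is_best X ->
  (forall t, (\rank (X + ofR k t *: H)%R <= K)%N) ->
  (forall Y, ip W Y = ip (b - A X) (A Y)) -> ip W H = 0.
Proof.
move=> [rX hX] rH hW; rewrite hW -opprB ipNl; apply/eqP; rewrite oppr_eq0.
apply/eqP; apply: (@quadratic_ge0_slope _ _ (frob (A H) ^+ 2)); last exact: sqr_ge0.
move=> t; have := hX _ (rH t); rewrite linearD linearZ /= addrAC.
rewrite -(@ler_pXn2r _ 2) ?nnegrE ?frob_ge0 //.
rewrite (frob_sqrD _ (ofR k t *: _)) ipZr frobZ exprMn.
by rewrite -normrX ger0_norm ?sqr_ge0 // -addrA lerDl.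
Qed.

Lemma riesz_le X W : (forall Y, ip W Y = ip (b - A X) (A Y)) ->
  frob W <= frob (A X - b).
Proof.
move=> hW; have [->|W0] := eqVneq W 0; first by rewrite frob0 frob_ge0.
have w0 : 0 < frob W by rewrite lt_neqAle frob_ge0 eq_sym frob_eq0 W0.
rewrite -(ler_pM2r w0) -expr2 frob_sqr hW; apply: le_trans (cauchy_schwarz _ _) _.
rewrite frobC ler_wpM2l ?frob_ge0 //; apply: le_trans (frob_opnorm _ _) _.
by rewrite ler_piMl ?frob_ge0 // ltW.
Qed.

(** Multiplying X on the right or left by 1 + t G does not raise its rank; suitable G give X^H W = 0
    and W X^H = 0. Hence W adds only pairs orthogonal to those of X, with values at most |W| <=
    |eps| <= c' sqrt(mu). *)
Lemma best_common_svd X W : is_best X -> (forall Y, ip W Y = ip (b - A X) (A Y)) ->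
  common_svd best_rel X (X + W).
Proof.
move=> hX hW; have [rX _] := hX.
have [r [U [x [V [hsvd x0]]]]] := svd_exists X; have [hU hV XE] := hsvd.
have xu : dg k x \in unitmx by apply: dg_unit => i; rewrite gt_eqF.
have XW : X^H *m W = 0.
  apply: ip_eq0; rewrite ip_mull adjmxK.
  set H := _ *m (_ *m _); have rH t : (\rank (X + ofR k t *: H)%R <= K)%N.
    rewrite /H scalemxAr -[X in X + _]mulmx1 -mulmxDr.
    exact: leq_trans (mxrankM_maxl _ _) rX.
  exact: (best_orth hX rH hW).
have WX : W *m X^H = 0.
  apply: ip_eq0; rewrite ip_mulr adjmxK.
  set H := _ *m _ *m _; have rH t : (\rank (X + ofR k t *: H)%R <= K)%N.
    rewrite /H scalemxAl -[X in X + _]mul1mx -mulmxDl.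
    exact: leq_trans (mxrankM_maxr _ _) rX.
  exact: (best_orth hX rH hW).
have UW : U^H *m W = 0.
  move: XW; rewrite XE !adjmxM adjmxK adjmx_dg -!mulmxA -(mulmx0 _ V).
  move/(isom_mulmx_inj hV) /(congr1 (mulmx (invmx (dg k x)))).
  by rewrite mulKmx // mulmx0.
have WV : W *m V = 0.
  move: WX; rewrite XE !adjmxM adjmxK adjmx_dg !mulmxA -(mul0mx _ U^H).
  move/(mulmx_isom_inj hU) /(congr1 (mulmx^~ (invmx (dg k x)))).
  by rewrite mulmxK // mul0mx.
apply: (@common_svd_extend _ _ _ _ _ _ _ _ U V x x) => //.
- by rewrite mulmxDr UW addr0 XE !mulmxA hU mul1mx.
- by rewrite mulmxDl WV addr0 XE -(mulmxA _ _ V) hV mulmx1.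
- move=> i; left; split=> //; have := best_svd i hX hsvd x0.
  by rewrite /c' [1 / (_ + _)]div1r ler_pdivlMl // inv_c'_gt0.
- move=> u v w w0 hu hv Uu _ Zw; right; split=> //; rewrite (ltW w0) /=.
  have <- : ip W (u *m v^H) = w.
    rewrite -Zw ipDl XE -(mulmxA U) [ip (U *m _) _]ip_mull.
    by rewrite (mulmxA U^H) Uu mul0mx ip0r add0r.
  apply: le_trans (ip_isom1 _ hu hv) (le_trans (riesz_le hW) _).
  exact: le_trans (best_residual hX) eps_le_c'.
Qed.

(** * Comparison of a stationary point with a best approximation *)

Lemma c'_le1 : c' <= 1.
Proof. by apply: ltW (lt_trans c'_lt c_lt1). Qed.

Lemma best_rel_subgrad x z : best_rel x z -> subgrad_rel mu x z.
Proof.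
have c0 := c'_gt0; have c1 := c'_le1; have e0 := e_gt0.
move=> [[-> ex]|[-> /andP [z0 ze]]]; last first.
  right; split=> //; rewrite z0 /=; apply: le_trans ze _.
  by rewrite ler_piMl // ltW.
have x0 : 0 < x by rewrite -(pmulr_rgt0 _ c0); exact: lt_le_trans ex.
left; split=> //; apply/esym/max_idPl; apply: le_trans ex _.
by rewrite ler_piMl // ltW.
Qed.

(** Equivalently, (x' - x)(z' - z) >= (1 - c')(x' - x)^2. Two pairs of [subgrad_rel] can violate
    this, as z is constant for 0 < x <= sqrt(mu); the gap in [best_rel] rules that out. *)
Lemma rel_mono x z x' z' : subgrad_rel mu x z -> best_rel x' z' ->
  0 <= (x' - x) * ((z' - (1 - c') * x') - (z - (1 - c') * x)).
Proof.
have c0 := c'_gt0; have c1 := c'_le1; have e0 := e_gt0.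
move=> [[x0 ->]|[-> /andP [z0 ze]]] [[-> ex]|[-> /andP [z'0 z'e]]].
- have [xe|/ltW xe] := leP x e; last first.
    rewrite (_ : _ * _ = c' * (x' - x) ^+ 2); last by ring.
    by rewrite mulr_ge0 ?sqr_ge0 // ltW.
  (* Here z = sqrt(mu) <= c' x', so the second factor is at least (1 - c') x. *)
  have xx' : x <= x'.
    apply: le_trans xe (le_trans ex _); rewrite ler_piMl //.
    by rewrite -(pmulr_rge0 _ c0); apply: le_trans ex; exact: ltW.
  rewrite mulr_ge0 ?subr_ge0 //.
  have : 0 <= (1 - c') * x by rewrite mulr_ge0 ?subr_ge0 // ltW.
  lra.
- rewrite sub0r mulNr -mulrN mulr_ge0 ?(ltW x0) //.
  have [xe|/ltW xe] := leP x e.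
    have : (1 - c') * x <= (1 - c') * e by rewrite ler_wpM2l ?subr_ge0.
    lra.
  have : c' * e <= c' * x by rewrite ler_pM2l.
  lra.
- rewrite mulr0 !subr0 mulr_ge0 //; last lra.
  by rewrite -(pmulr_rge0 _ c0); apply: le_trans ex; exact: ltW.
- by rewrite subrr mul0r.
Qed.

Lemma rel_ge0 x z : subgrad_rel mu x z -> 0 <= x /\ 0 <= z - (1 - c') * x.
Proof.
have c0 := c'_gt0; have c1 := c'_le1; have e0 := e_gt0.
move=> [[x0 ->]|[-> /andP [z0 ze]]]; last by rewrite mulr0 subr0.
split; first exact: ltW.
have : x <= Num.max x e by rewrite le_max lexx.
have : 0 <= c' * x by rewrite mulr_ge0 // ltW.
lra.
Qed.

(** Z - (1 - c') X has the same singular vectors as X, so [mono_pairs] applies to it. *)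
Lemma common_svd_mono (X Z X' Z' : 'M[F]_(n1, n2)) :
  common_svd (subgrad_rel mu) X Z -> common_svd best_rel X' Z' ->
  (1 - c') * frob (X' - X) ^+ 2 <= ip (X' - X) (Z' - Z).
Proof.
move=> [r [U [V [x [z [hU hV XE ZE hxz]]]]]].
move=> [r' [U' [V' [x' [z' [hU' hV' XE' ZE' hxz']]]]]].
pose y i := z i - (1 - c') * x i; pose y' i := z' i - (1 - c') * x' i.
have YE s (U1 : 'M[F]_(n1, s)) (V1 : 'M[F]_(n2, s)) x1 z1 :
    U1 *m dg k (fun i => z1 i - (1 - c') * x1 i) *m V1^H =
    U1 *m dg k z1 *m V1^H - ofR k (1 - c') *: (U1 *m dg k x1 *m V1^H).
  have -> : dg k (fun i => z1 i - (1 - c') * x1 i) = dg k z1 - ofR k (1 - c') *: dg k x1.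
    by apply/matrixP => i j; rewrite !mxE rmorphB rmorphM;
      case: eqP => _; rewrite ?mulr1n ?mulr0n ?mulr0 ?subr0.
  by rewrite mulmxBr mulmxBl -scalemxAr -scalemxAl.
have := @mono_pairs _ k _ _ _ _ U V x y U' V' x' y' hU hV hU' hV'.
rewrite !YE -XE -XE' -ZE -ZE' => h.
have {}h : 0 <= ip (X' - X) (Z' - Z - ofR k (1 - c') *: (X' - X)).
  have -> : Z' - Z - ofR k (1 - c') *: (X' - X) =
     Z' - ofR k (1 - c') *: X' - (Z - ofR k (1 - c') *: X).
    by apply/matrixP => i j; rewrite !mxE; ring.
  apply: h.
  - by move=> i; have [] := rel_ge0 (hxz i).
  - by move=> i; have [] := rel_ge0 (hxz i).
  - by move=> i; have [] := rel_ge0 (best_rel_subgrad (hxz' i)).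
  - by move=> i; have [] := rel_ge0 (best_rel_subgrad (hxz' i)).
  - by move=> i j; exact: rel_mono.
by move: h; rewrite (ipBr (Z' - Z)) ipZr subr_ge0 -frob_sqr.
Qed.

Lemma common_svd_unique X W X' W' :
  (\rank X <= K)%N -> (\rank X' <= K)%N ->
  (forall Y, ip W Y = ip (b - A X) (A Y)) ->
  (forall Y, ip W' Y = ip (b - A X') (A Y)) ->
  common_svd (subgrad_rel mu) X (X + W) -> common_svd best_rel X' (X' + W') -> X = X'.
Proof.
move=> rX rX' hW hW' hX hX'; have := common_svd_mono hX hX'.
rewrite (_ : X' + W' - (X + W) = (X' - X) + (W' - W)); last first.
  by rewrite opprD addrACA.
rewrite (ipDr (X' - X)) (ipC _ (W' - W)) (ipBl W' W) hW hW' -ipBl.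
rewrite (_ : b - A X' - (b - A X) = - A (X' - X)); last first.
  rewrite (_ : A (X' - X) = A X' - A X); last by rewrite linearB.
  by apply/matrixP => i j; rewrite !mxE; ring.
rewrite ipNl -!frob_sqr => h.
have rD : (\rank (X' - X)%R <= 2 * K)%N.
  apply: leq_trans (mxrank_add _ _) _; rewrite eqmx_opp mul2n -addnn.
  exact: leq_add.
have h2 := ricP rD; have cc := c'_lt.
have : (c - c') * frob (X' - X) ^+ 2 <= 0 by rewrite mulrBl; lra.
rewrite pmulr_rle0 ?subr_gt0 // => h3.
have : frob (X' - X) ^+ 2 == 0 by rewrite eq_le h3 sqr_ge0.
by rewrite sqrf_eq0 frob_eq0 subr_eq0 => /eqP.
Qed.

Lemma best_unique X X' : is_best X -> is_best X' -> X = X'.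
Proof.
move=> hX hX'; have [W hW] := riesz A (b - A X); have [W' hW'] := riesz A (b - A X').
apply: (common_svd_unique (proj1 hX) (proj1 hX') hW hW'); last exact: best_common_svd.
have [r [U [V [x [z [hU hV XE ZE hxz]]]]]] := best_common_svd hX hW.
by exists r, U, V, x, z; split=> // i; exact: best_rel_subgrad.
Qed.

Lemma stationary_unique X X' : is_best X' -> (\rank X <= K)%N ->
  stationary (R_mu_reg mu A b) X -> X = X'.
Proof.
move=> hX' rX hX; have [W hW] := riesz A (b - A X).
have [W' hW'] := riesz A (b - A X').
apply: (common_svd_unique rX (proj1 hX') hW hW'); last exact: best_common_svd.
exact: (Phi_subgrad_common_svd mu_gt0 (stationary_Phi_subgrad hW hX)).
Qed.

(** At equal rank this is uniqueness of the best approximation. A rank above K costs at least mu >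
    |eps|^2 more. With d = K - rank X' > 0, the Eckart-Young bound makes the squared residual of X'
    larger than d mu + |eps|^2. *)
Lemma R_mu_best_lt X X' : is_best X -> X' <> X -> R_mu mu A b X < R_mu mu A b X'.
Proof.
move=> hX XX'; have [rX hX2] := hX; have e0 := e_gt0.
have resX : frob (A X - b) ^+ 2 <= frob eps ^+ 2.
  by rewrite ler_pXn2r ?nnegrE ?frob_ge0 // best_residual.
have muX : mu * (\rank X)%:R <= mu * K%:R by rewrite ler_pM2l // ler_nat.
have epsmu := eps_lt; rewrite /R_mu.
have [rX'|rX'|rX'] := ltngtP (\rank X') K.
- have [U0 [s [V0 [h0 s0]]]] := svd_X0.
  have := low_rank_distance h0 sigma0_ge0 s0 (leqnn (\rank X')).
  rewrite -natrB ?(ltnW rX') //; set d := (K - \rank X')%N => hd.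
  have d1 : 1 <= d%:R :> R by rewrite ler1n subn_gt0.
  have KE : K%:R = d%:R + (\rank X')%:R :> R by rewrite -natrD subnK // ltnW.
  have rD : (\rank (X' - X0)%R <= 2 * K)%N.
    apply: leq_trans (mxrank_add _ _) _; rewrite eqmx_opp mul2n -addnn rank_X0.
    by rewrite leq_add2r ltnW.
  have /andP [q0 q1] := sqrt_c; have qc : Num.sqrt c ^+ 2 = c by rewrite sqr_sqrtr // ltW.
  set q := Num.sqrt c in q0 q1 qc.
  pose sd := Num.sqrt d%:R : R.
  have sd2 : sd ^+ 2 = d%:R by rewrite sqr_sqrtr // ler0n.
  have sd1 : 1 <= sd by rewrite -[leLHS]sqrtr1 ler_wsqrtr.
  (* As c = q^2, the factor q sqrt(c) (1/c + c) equals 1 + q^4. *)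
  have h1 : sd * e * (1 + q ^+ 4) <= q * frob (A (X' - X0)).
    rewrite -(@ler_pXn2r _ 2) ?nnegrE ?mulr_ge0 ?frob_ge0 ?(ltW q0) ?(ltW e0) //;
      last first.
    - by rewrite addr_ge0 // exprn_ge0 // ltW.
    - exact: le_trans ler01 sd1.
    rewrite exprMn [leRHS]exprMn; apply: le_trans (ler_wpM2l (sqr_ge0 q) (ricP rD)).
    apply: le_trans (ler_wpM2l _ (ler_wpM2l (ltW c_gt0) hd)); last exact: sqr_ge0.
    rewrite -sd2 -qc; have q2 : q != 0 by rewrite gt_eqF.
    by rewrite le_eqVlt; apply/orP; left; apply/eqP; field.
  have h2 : frob (A (X' - X0)) <= frob (A X' - b) + frob eps.
    rewrite (_ : A (X' - X0) = (A X' - b) + eps); first exact: frobD.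
    by rewrite linearB /= bE opprD addrA subrK.
  have h3 : frob eps <= q ^+ 3 * e / 3.
    by have := eps_le; rewrite -/q -{1}qc -exprSr.
  have h4 : sd * e * (1 + 2 / 3 * q ^+ 4) <= frob (A X' - b).
    have q4 : 0 <= q ^+ 4 by rewrite exprn_ge0 // ltW.
    have h5 : q * frob eps <= sd * (q ^+ 4 * e / 3).
      apply: (@le_trans _ _ (q ^+ 4 * e / 3)).
        apply: le_trans (ler_wpM2l (ltW q0) h3) _.
        by rewrite le_eqVlt; apply/orP; left; apply/eqP; field.
      by rewrite ler_peMl // divr_ge0 // mulr_ge0 // ltW.
    have h6 : q * frob (A X' - b) <= frob (A X' - b) by rewrite ler_piMl ?frob_ge0.
    have h7 : q * frob (A (X' - X0)) <= q * frob (A X' - b) + q * frob eps.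
      by rewrite -mulrDr ler_pM2l.
    lra.
  have h5 : d%:R * mu * (1 + 2 / 3 * q ^+ 4) ^+ 2 <= frob (A X' - b) ^+ 2.
    rewrite -sd2 -(sqrt_mu_sqr mu_gt0) -!exprMn ler_pXn2r ?nnegrE ?frob_ge0 //.
    rewrite mulr_ge0 ?addr_ge0 ?mulr_ge0 ?exprn_ge0 ?divr_ge0 ?(ltW q0) ?(ltW e0) //.
    exact: le_trans ler01 sd1.
  have h6 : frob eps ^+ 2 <= mu * (q ^+ 4 / 9).
    rewrite -(sqrt_mu_sqr mu_gt0); apply: (@le_trans _ _ ((q ^+ 3 * e / 3) ^+ 2)).
      by rewrite ler_pXn2r ?nnegrE ?frob_ge0 // ?divr_ge0 ?mulr_ge0 ?exprn_ge0 // ltW.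
    rewrite (_ : _ ^+ 2 = e ^+ 2 * (q ^+ 4 / 9) * q ^+ 2); last by field.
    rewrite ler_piMr ?mulr_ge0 ?divr_ge0 ?exprn_ge0 ?(ltW q0) ?(ltW e0) //.
    by rewrite exprn_ile1 // ltW.
  have q4 : 0 < q ^+ 4 by rewrite exprn_gt0.
  (* The square on the right exceeds 1 by at least (4/3) q^4, more than the q^4 / 9 due to the
     noise. *)
  have h7 : mu * (q ^+ 4 / 9) + d%:R * mu < d%:R * mu * (1 + 2 / 3 * q ^+ 4) ^+ 2.
    have dm : mu <= d%:R * mu by rewrite ler_peMl // ltW.
    have h8 : mu * (q ^+ 4 / 9) <= d%:R * mu * (q ^+ 4 / 9).
      by rewrite ler_wpM2r // divr_ge0 // ltW.
    have h9 : 0 < d%:R * mu * q ^+ 4 by rewrite !mulr_gt0 // (lt_le_trans ltr01).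
    have h10 : 0 <= d%:R * mu * (q ^+ 4) ^+ 2.
      by rewrite mulr_ge0 ?sqr_ge0 // (le_trans (ltW mu_gt0)).
    nra.
  rewrite KE mulrDr in muX; lra.
- have : mu * (K%:R + 1) <= mu * (\rank X')%:R.
    by rewrite ler_pM2l // natr1 ler_nat.
  have := sqr_ge0 (frob (A X' - b)); rewrite mulrDr mulr1; lra.
- have lt : frob (A X - b) < frob (A X' - b).
    rewrite ltNge; apply/negP => le; apply: XX'; apply: best_unique => //.
    split=> [|Y rY]; first by rewrite rX'.
    exact: le_trans le (hX2 _ rY).
  rewrite rX'; apply: ler_ltD => //.
  by rewrite ltr_pXn2r ?nnegrE ?frob_ge0.
Qed.

Lemma R_mu_reg_le X : R_mu_reg mu A b X <= R_mu mu A b X.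
Proof.
have [r [U [s [V [hX s0]]]]] := svd_exists X.
rewrite /R_mu_reg /R_mu lerD2r (sum_sigma hX (fun i => ltW (s0 i)) (r_mu0 mu_gt0)).
rewrite (svd_rank hX) => [|i]; last by rewrite gt_eqF.
rewrite mulr_natr -[X in _ *+ X]card_ord -sumr_const.
by apply: ler_sum => i _; exact: r_mu_le.
Qed.

(** Let Y be X' with its singular values pushed to 0 or beyond sqrt(mu). Then [R_mu_reg] at X is at
    most [R_mu] at X, at most [R_mu] at Y, at most [R_mu_reg] at X'. Strictness comes from the
    pushing; if nothing was pushed, both functionals agree at X' and the previous comparison is
    strict. *)
Lemma R_mu_reg_best_lt X X' : is_best X -> X' <> X ->
  R_mu_reg mu A b X < R_mu_reg mu A b X'.
Proof.
move=> hX XX'; apply: le_lt_trans (R_mu_reg_le X) _.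
have [r [U [s [V [hsvd s0]]]]] := svd_exists X'.
have s0' i := ltW (s0 i); have [hU hV X'E] := hsvd.
have [s' [s'e pen_le pen_lt]] := push_endpoints mu_gt0 b A_lt1 hU hV s0'.
pose Y := U *m dg k s' *m V^H.
have regE : R_mu_reg mu A b X' =
    \sum_i r_mu mu (s i) + frob (A (U *m dg k s *m V^H) - b) ^+ 2.
  by rewrite /R_mu_reg (sum_sigma hsvd s0' (r_mu0 mu_gt0)) -X'E.
have hY : R_mu mu A b Y <=
    \sum_i r_mu mu (s' i) + frob (A (U *m dg k s' *m V^H) - b) ^+ 2.
  rewrite /R_mu lerD2r (bigID (fun i => s' i != 0)) /= [X in _ + X]big1; last first.
    by move=> i; rewrite negbK => /eqP ->; rewrite r_mu0.
  rewrite addr0 (eq_bigr (fun=> mu)) => [|i si]; last first.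
    rewrite r_mu_large //; have [si0|] := s'e i => //.
    by rewrite si0 eqxx in si.
  rewrite sumr_const -[leRHS]mulr_natr ler_pM2l // ler_nat.
  exact: rank_svd_le.
have hXY : R_mu mu A b X <= R_mu mu A b Y.
  have [->|YX] := pselect (Y = X); first exact: lexx.
  by apply/ltW/R_mu_best_lt.
rewrite regE; have [/existsP hi|/existsPn hi] := boolP [exists i, 0 < s i < e].
  by apply: le_lt_trans (le_trans hXY hY) (pen_lt hi).
suff -> : \sum_i r_mu mu (s i) + frob (A (U *m dg k s *m V^H) - b) ^+ 2 =
  R_mu mu A b X' by exact: R_mu_best_lt.
rewrite /R_mu -X'E (svd_rank hsvd) => [|i]; last by rewrite gt_eqF.
congr (_ + _); rewrite (eq_bigr (fun=> mu)) ?sumr_const ?card_ord ?mulr_natr //.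
move=> i _; rewrite r_mu_large //; have := hi i.
by rewrite s0 /= -leNgt.
Qed.

Lemma argmin_eq (T : Type) (D : set T) (g : T -> R) x :
  D x -> (forall y, D y -> y <> x -> g x < g y) -> argmin D g = [set x].
Proof.
move=> Dx h; apply/seteqP; split=> y /=.
  move=> [Dy /(_ x Dx) yx]; apply: contrapT => nxy.
  by have := h y Dy nxy; rewrite ltNge yx.
move=> ->; split=> // z Dz; have [->//|nzx] := pselect (z = x).
by apply: ltW; exact: h.
Qed.

Lemma best_argmin X : is_best X ->
  argmin [set X | (\rank X <= K)%N] (fun X => frob (A X - b)) = [set X].
Proof.
move=> hX; have [rX hX2] := hX; apply: argmin_eq => // Y rY YX.
rewrite ltNge; apply/negP => le; apply: YX; apply: best_unique => //.
by split=> // Z rZ; exact: le_trans le (hX2 _ rZ).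
Qed.

End Recovery.

Unset Implicit Arguments.

Theorem theorem1p1 (R : realType) (k : scalar_kind) (n1 n2 m : nat) (mu : R)
    (A : {linear 'M[entries R k]_(n1, n2) -> 'cV[entries R k]_m}) (K : nat)
    (X0 : 'M[entries R k]_(n1, n2)) (eps b : 'cV[entries R k]_m)
    (mu_gt0 : 0 < mu)
    (A_lt1 : opnorm A < 1)
    (K_ge1 : (1 <= K)%N)
    (ric_lt1 : lower_ric A (2 * K) < 1)
    (bE : b = A X0 + eps)
    (rank_X0 : \rank X0 = K)
    (eps_le : frob eps <=
      (1 - lower_ric A (2 * K)) `^ (3 / 2) * Num.sqrt mu / 3)
    (sigma_gt : (1 / (1 - lower_ric A (2 * K)) + (1 - lower_ric A (2 * K)))
        * Num.sqrt mu < sigma X0 K.-1) :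
  exists XB : 'M[entries R k]_(n1, n2),
    [/\ argmin [set X | (\rank X <= K)%N] (fun X => frob (A X - b)) = [set XB],
        argmin setT (R_mu_reg mu A b) = [set XB],
        argmin setT (R_mu mu A b) = [set XB],
        frob (XB - X0) <= 2 * frob eps / Num.sqrt (1 - lower_ric A (2 * K))
      & forall X : 'M[entries R k]_(n1, n2),
          stationary (R_mu_reg mu A b) X -> X <> XB -> (K < \rank X)%N].
Proof.
set c := 1 - lower_ric A (2 * K) in eps_le sigma_gt *.
have c_gt0 : 0 < c by rewrite subr_gt0.
have ricP X : (\rank X <= 2 * K)%N -> c * frob X ^+ 2 <= frob (A X) ^+ 2.
  exact: lower_ric_bound.
have {}eps_le : frob eps <= c * Num.sqrt c * Num.sqrt mu / 3.
  suff <- : c `^ (3 / 2) = c * Num.sqrt c by [].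
  rewrite (_ : 3 / 2 = 1 + 2^-1); last by field.
  rewrite powRD; last by apply/implyP => _; rewrite gt_eqF.
  by rewrite powRr1 ?(ltW c_gt0) // powR12_sqrt // ltW.
have [|XB rXB hXB] := @best_low_rank _ _ _ _ _ A b K c c_gt0.
  by move=> X rX; apply: ricP; apply: leq_trans rX _; rewrite mul2n -addnn leq_addr.
have best : is_best A K b XB by [].
exists XB; split.
- exact: (best_argmin mu_gt0 A_lt1 K_ge1 c_gt0 ricP bE rank_X0 eps_le sigma_gt).
- by apply: argmin_eq => // Y _; apply: R_mu_reg_best_lt; eassumption.
- by apply: argmin_eq => // Y _; apply: R_mu_best_lt; eassumption.
- by apply: best_error; eassumption.
- move=> X hX XXB; rewrite ltnNge; apply/negP => rX; apply: XXB.
  exact: (stationary_unique mu_gt0 A_lt1 K_ge1 c_gt0 ricP bE rank_X0 eps_le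
    sigma_gt best rX hX).
Qed.
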